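(* Suppose $\vdash_{\mathit{RS}_{1.1}^-} f:\gamma_1\to\gamma_0$ where $\gamma_1$ is normal. Then $f$ is DP-poly-cost, i.e. there is a polynomial $q$ such that for every type-$\gamma_1$ value $v$, the cost of evaluating $f$ on $v$ under the dynamic-programming semantics is at most $q(\mathrm{size}(v))$.
   Context: $S_1^-$ is a first-order call-by-value typed $\lambda$-calculus with ground types built from $\mathsf{unit}$ and inductive data types $\mu P$ ($P$ a polynomial functor built from $\mathrm{Id}$, constant functors, $+,\times$; $\mu P$ its nonempty least fixed point) using $+,\times$; terms: $\lambda$, application, pairs/projections, injections/case, constructors $\mathsf{c}_{\mu P}:P(\mu P)\to\mu P$, destructors $\mathsf{d}_{\mu P}:\mu P\to P(\mu P)$ and structural recursion $\mathsf{fold}_{\mu P} f\,e$ ($(\mathsf{fold} f)\circ\mathsf{c}=f\circ P(\mathsf{fold} f)$). Values are rooted labelled dags (vertices $\underline{()}$, $\underline\iota_j$, pair, $\underline{\mathsf c}_{\mu P}$) with sharing; bisimilar values unfold to the same tree; $\mathrm{size}(v)$ = number of $\underline{\mathsf c}_{\mu P}$ vertices. The dynamic-programming (DP) semantics is call-by-value evaluation where constructors create a fresh vertex and folds are evaluated bottom-up over the argument dag, memoizing the result at each vertex; the DP-cost of an evaluation is the number of nodes of its derivation tree. $\mathit{RS}^-_1$ ramifies $S_1^-$: each ground type $\gamma$ has a safe version $\mathsf S\gamma$ ($\mathsf S$ distributing over $+,\times$), with safe constructors/destructors; $\mathsf{fold}_\delta(\lambda z.e_0)\,e_1$ requires $e_1:\delta$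 normal and $\lambda z.e_0:P(\mathsf S\gamma)\to\mathsf S\gamma$, of type $\mathsf S\gamma$; case needs normal scrutinee type or safe result type; $\mathsf{toSafe}:\gamma\to\mathsf S\gamma$; $\mathsf{toNorm}:\gamma\to\mathsf N\gamma$ only if all free variables of its argument have normal type. A type is normal if all its base types are non-safe. Semantics: the DP semantics, coercions are identities. $\mathit{RS}_{1.1}^-$ adds, for each data type $\delta$, a primitive $\mathsf{cs}_\delta$ ($e:\delta\vdash\mathsf{cs}_\delta e:\mathsf{nat}$, $\mathsf{nat}=\mu(\mathsf C_{\mathsf{unit}}+\mathrm{Id})$) returning the numeral of $\min\{\mathrm{size}(v')\mid v'\text{ bisimilar to the value of }e\}$. *)

(* Defs.v *)
From HB Require Import structures.
From mathcomp Require Import all_boot all_algebra.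

Set Implicit Arguments.
Unset Strict Implicit.
Unset Printing Implicit Defensive.

(** * Ground types and polynomial functors *)

Inductive gty : Type :=
| GUnit
| GMu of pfun
| GSum of gty & gty
| GProd of gty & gty
with pfun : Type :=
| PId
| PCst of gty
| PSum of pfun & pfun
| PProd of pfun & pfun.

(** Decidable equality, needed to test vertex labels. *)
Fixpoint gty_eqb (A B : gty) : bool :=
  match A, B with
  | GUnit, GUnit => true
  | GMu P, GMu Q => pfun_eqb P Q
  | GSum A1 A2, GSum B1 B2 => gty_eqb A1 B1 && gty_eqb A2 B2
  | GProd A1 A2, GProd B1 B2 => gty_eqb A1 B1 && gty_eqb A2 B2
  | _, _ => false
  end
with pfun_eqb (P Q : pfun) : bool :=
  match P, Q with
  | PId, PId => true
  | PCst A, PCst B => gty_eqb A B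
  | PSum P1 P2, PSum Q1 Q2 => pfun_eqb P1 Q1 && pfun_eqb P2 Q2
  | PProd P1 P2, PProd Q1 Q2 => pfun_eqb P1 Q1 && pfun_eqb P2 Q2
  | _, _ => false
  end.

Scheme gty_mutind := Induction for gty Sort Prop
with pfun_mutind := Induction for pfun Sort Prop.
Combined Scheme gty_pfun_ind from gty_mutind, pfun_mutind.

Lemma gty_pfun_eqbP :
  (forall A B, gty_eqb A B <-> A = B) /\ (forall P Q, pfun_eqb P Q <-> P = Q).
Proof.
apply: gty_pfun_ind =>
    [|P IH|A IHA B IHB|A IHA B IHB||A IH|P IHP Q IHQ|P IHP Q IHQ]
    [|P'|A' B'|A' B'] //=.
all: try by split=> [/IH ->|[/IH]].
all: try by split=> [/andP[/IHA -> /IHB ->]|[/IHA -> /IHB ->]].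
all: by split=> [/andP[/IHP -> /IHQ ->]|[/IHP -> /IHQ ->]].
Qed.

Lemma gty_eqbP : Equality.axiom gty_eqb.
Proof. by move=> A B; apply: (iffP idP) => /gty_pfun_eqbP.1. Qed.

Lemma pfun_eqbP : Equality.axiom pfun_eqb.
Proof. by move=> P Q; apply: (iffP idP) => /gty_pfun_eqbP.2. Qed.

HB.instance Definition _ := hasDecEq.Build gty gty_eqbP.
HB.instance Definition _ := hasDecEq.Build pfun pfun_eqbP.

(** [gapp P A] is the ground type P(A). *)
Fixpoint gapp (P : pfun) (A : gty) : gty :=
  match P with
  | PId => A
  | PCst B => B
  | PSum P1 P2 => GSum (gapp P1 A) (gapp P2 A)
  | PProd P1 P2 => GProd (gapp P1 A) (gapp P2 A)
  end.

(** The least fixed point of P is nonempty iff P(0) is, all constants of P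
    being themselves nonempty. *)
Fixpoint at0_inhabited (P : pfun) : bool :=
  match P with
  | PId => false
  | PCst _ => true
  | PSum P1 P2 => at0_inhabited P1 || at0_inhabited P2
  | PProd P1 P2 => at0_inhabited P1 && at0_inhabited P2
  end.

(** Every data type occurring in the type is nonempty. *)
Fixpoint gty_ok (A : gty) : bool :=
  match A with
  | GUnit => true
  | GMu P => at0_inhabited P && pfun_ok P
  | GSum B C | GProd B C => gty_ok B && gty_ok C
  end
with pfun_ok (P : pfun) : bool :=
  match P with
  | PId => true
  | PCst A => gty_ok A
  | PSum P1 P2 | PProd P1 P2 => pfun_ok P1 && pfun_ok P2
  end.

(** * Ramified types *)

Inductive mode : Type := Normal | Safe.

(** A ramified ground type is a sum-product type over base types carrying a
    mode: [RUnit Safe] and [RMu Safe P] are the safe versions S unit and S mu P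
    of the normal base types [RUnit Normal] and [RMu Normal P]. *)
Inductive rty : Type :=
| RUnit of mode
| RMu of mode & pfun
| RSum of rty & rty
| RProd of rty & rty.

Fixpoint erase (A : rty) : gty :=
  match A with
  | RUnit _ => GUnit
  | RMu _ P => GMu P
  | RSum B C => GSum (erase B) (erase C)
  | RProd B C => GProd (erase B) (erase C)
  end.

(** All base types put at mode m: [annot Normal] embeds the unramified ground
    types and [annot Safe] is S. *)
Fixpoint annot (m : mode) (A : gty) : rty :=
  match A with
  | GUnit => RUnit m
  | GMu P => RMu m P
  | GSum B C => RSum (annot m B) (annot m C)
  | GProd B C => RProd (annot m B) (annot m C)
  end.

(** S and N on types that may already be ramified; S is idempotent and N
    undoes S. *)
Definition toS (A : rty) : rty := annot Safe (erase A).
Definition toN (A : rty) : rty := annot Normal (erase A).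

Fixpoint normal_ty (A : rty) : bool :=
  match A with
  | RUnit m | RMu m _ => if m is Normal then true else false
  | RSum B C | RProd B C => normal_ty B && normal_ty C
  end.

Fixpoint safe_ty (A : rty) : bool :=
  match A with
  | RUnit m | RMu m _ => if m is Safe then true else false
  | RSum B C | RProd B C => safe_ty B && safe_ty C
  end.

(** P(A) for a ramified A: the constants of P are normal, whatever A is. *)
Fixpoint rapp (P : pfun) (A : rty) : rty :=
  match P with
  | PId => A
  | PCst B => annot Normal B
  | PSum P1 P2 => RSum (rapp P1 A) (rapp P2 A)
  | PProd P1 P2 => RProd (rapp P1 A) (rapp P2 A)
  end.

(** First-order types: gamma_1 -> ... -> gamma_k -> gamma_0. *)
Inductive ty : Type :=
| Ground of rty
| Arrow of rty & ty.

(** * Terms and typing *)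

(** De Bruijn terms; the binders are [Lam], the branches of [Case] and the step
    of [Fold].  [Inj true] and [Inj false] are the left and right injections.
    [Fold P e0 e1] is fold_{mu P} (lambda z. e0) e1 with z the variable 0 of
    e0. *)
Inductive tm : Type :=
| Var of nat
| Lam of tm
| App of tm & tm
| Unit
| Pair of tm & tm
| Fst of tm
| Snd of tm
| Inj of bool & tm
| Case of tm & tm & tm
| Con of mode & pfun & tm
| Des of mode & pfun & tm
| Fold of pfun & tm & tm
| ToSafe of tm
| ToNorm of tm
| CS of pfun & tm.

Definition unbind (s : seq nat) : seq nat := [seq i.-1 | i <- s & i != 0].

Fixpoint fv (e : tm) : seq nat :=
  match e with
  | Var i => [:: i]
  | Lam e => unbind (fv e)
  | App e1 e2 | Pair e1 e2 => fv e1 ++ fv e2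
  | Unit => [::]
  | Fst e | Snd e | Inj _ e | Con _ _ e | Des _ _ e
  | ToSafe e | ToNorm e | CS _ e => fv e
  | Case e e1 e2 => fv e ++ unbind (fv e1) ++ unbind (fv e2)
  | Fold _ e0 e1 => unbind (fv e0) ++ fv e1
  end.

Definition natP : pfun := PSum (PCst GUnit) PId.

(** Typing of RS_{1.1}^-.  For a safe data type the constructor and the
    destructor mediate between S(P(mu P)) and S(mu P), so that the constants of
    P are made safe as well; in the step of a fold, on the contrary, the
    constants in P(S gamma) stay normal.  The [gty_ok] premises only ensure that
    all types mentioned are built from nonempty data types. *)
Inductive typed : seq rty -> tm -> ty -> Prop :=
| T_Var G i A :
    onth G i = Some A -> typed G (Var i) (Ground A)
| T_Lam G A T e :
    gty_ok (erase A) -> typed (A :: G) e T -> typed G (Lam e) (Arrow A T)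
| T_App G A T e1 e2 :
    typed G e1 (Arrow A T) -> typed G e2 (Ground A) -> typed G (App e1 e2) T
| T_Unit G :
    typed G Unit (Ground (RUnit Normal))
| T_Pair G A B e1 e2 :
    typed G e1 (Ground A) -> typed G e2 (Ground B) ->
    typed G (Pair e1 e2) (Ground (RProd A B))
| T_Fst G A B e :
    typed G e (Ground (RProd A B)) -> typed G (Fst e) (Ground A)
| T_Snd G A B e :
    typed G e (Ground (RProd A B)) -> typed G (Snd e) (Ground B)
| T_InjL G A B e :
    gty_ok (erase B) ->
    typed G e (Ground A) -> typed G (Inj true e) (Ground (RSum A B))
| T_InjR G A B e :
    gty_ok (erase A) ->
    typed G e (Ground B) -> typed G (Inj false e) (Ground (RSum A B))
| T_Case G A B C e e1 e2 :
    typed G e (Ground (RSum A B)) ->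
    typed (A :: G) e1 (Ground C) -> typed (B :: G) e2 (Ground C) ->
    normal_ty (RSum A B) || safe_ty C ->
    typed G (Case e e1 e2) (Ground C)
| T_Con_normal G P e :
    gty_ok (GMu P) ->
    typed G e (Ground (rapp P (RMu Normal P))) ->
    typed G (Con Normal P e) (Ground (RMu Normal P))
| T_Con_safe G P e :
    gty_ok (GMu P) ->
    typed G e (Ground (toS (rapp P (RMu Normal P)))) ->
    typed G (Con Safe P e) (Ground (RMu Safe P))
| T_Des_normal G P e :
    typed G e (Ground (RMu Normal P)) ->
    typed G (Des Normal P e) (Ground (rapp P (RMu Normal P)))
| T_Des_safe G P e :
    typed G e (Ground (RMu Safe P)) ->
    typed G (Des Safe P e) (Ground (toS (rapp P (RMu Normal P))))
| T_Fold G P (A : gty) e0 e1 :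
    gty_ok A ->
    typed (rapp P (annot Safe A) :: G) e0 (Ground (annot Safe A)) ->
    typed G e1 (Ground (RMu Normal P)) ->
    typed G (Fold P e0 e1) (Ground (annot Safe A))
| T_ToSafe G A e :
    typed G e (Ground A) -> typed G (ToSafe e) (Ground (toS A))
| T_ToNorm G A e :
    typed G e (Ground A) ->
    all (fun i => normal_ty (nth (RUnit Safe) G i)) (fv e) ->
    typed G (ToNorm e) (Ground (toN A))
| T_CS G P e :
    typed G e (Ground (RMu Normal P)) ->
    typed G (CS P e) (Ground (RMu Normal natP)).

(** * Stores and values *)

Definition addr := nat.

(** Vertices of a dag, with the addresses of their children. *)
Inductive node : Type :=
| NUnit
| NInj of bool & addr
| NPair of addr & addr
| NCon of pfun & addr.

Definition children (n : node) : seq addr :=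
  match n with
  | NUnit => [::]
  | NInj _ a | NCon _ a => [:: a]
  | NPair a b => [:: a; b]
  end.

(** A store lists vertices, newest first; the address of a vertex is the number
    of vertices older than it, so allocating in h yields the address [size h]
    and leaves all other addresses valid. *)
Definition store := seq node.

Fixpoint lookup (h : store) (a : addr) : option node :=
  if h is n :: h' then if a == size h' then Some n else lookup h' a else None.

(** Children are older than their parents; every finite dag can be laid out in
    this way. *)
Fixpoint wf_store (h : store) : bool :=
  if h is n :: h' then all (fun a => a < size h') (children n) && wf_store h'
  else true.

(** The addresses reachable from those in s, in decreasing order: one sweep
    from the newest vertex to the oldest. *)
Fixpoint reach (h : store) (s : seq addr) : seq addr :=
  if h is n :: h' then
    if size h' \in s then size h' :: reach h' (children n ++ s) else reach h' s
  else [::].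

Definition edge (h : store) : rel addr :=
  fun a b => if lookup h a is Some n then b \in children n else false.

Lemma edge_lt h a b : wf_store h -> edge h a b -> b < a.
Proof.
elim: h => //= n h IH /andP[/allP hn wf]; rewrite /edge /=.
by case: eqP => [-> /hn//|_]; exact: IH.
Qed.

Lemma path_old h n a p : wf_store (n :: h) -> a < size h ->
  path (edge (n :: h)) a p = path (edge h) a p.
Proof.
move=> /= /andP[_ wf]; elim: p a => //= b p IH a lta.
rewrite {1}/edge /= (ltn_eqF lta) -/(edge h a b).
by case: (boolP (edge h a b)) => //= /(edge_lt wf) /ltn_trans/(_ lta)/IH.
Qed.

(** On well-formed stores, [reach] is reachability in the dag. *)
Lemma reachP h s b : wf_store h ->
  b \in reach h s <->
  exists a p, [/\ a \in s, a < size h, path (edge h) a p & b = last a p].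
Proof.
elim: h s => [|n h IH] s; first by move=> _; split=> // -[a [p []]].
move=> wfn; have /andP[/allP hn wf] := wfn.
have old a p := @path_old h n a p wfn.
have keep t : (exists a p,
      [/\ a \in t, a < size h, path (edge h) a p & b = last a p]) ->
    exists a p, [/\ a \in t, a < size (n :: h),
      path (edge (n :: h)) a p & b = last a p].
  by move=> [a [p [at_ lta pa ->]]]; exists a, p; rewrite old //= ltnW.
rewrite /=; case: ifP => hs; last first.
  split=> [/(IH _ wf)/keep//|[a [p [as_]]]].
  rewrite ltnS leq_eqVlt => /orP[/eqP ea|lta]; first by rewrite ea hs in as_.
  by rewrite old // => pa eb; apply/(IH _ wf); exists a, p.
rewrite inE; split=> [/orP[/eqP ->|/(IH _ wf)[a [p [+ lta pa eb]]]]|].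
- by exists (size h), [::].
- rewrite mem_cat => /orP[an|as_]; last by apply: keep; exists a, p.
  exists (size h), (a :: p); split=> //=; rewrite /edge /= eqxx an.
  by rewrite -/(edge (n :: h)) old.
move=> [a [p [as_]]]; rewrite ltnS leq_eqVlt => /orP[/eqP ->|lta]; last first.
  rewrite old // => pa eb; apply/orP; right; apply/(IH _ wf).
  by exists a, p; rewrite mem_cat as_ orbT.
case: p => [|c p] /=; first by move=> _ ->; rewrite eqxx.
rewrite {1}/edge /= eqxx => /andP[cn]; have ltc := hn _ cn.
rewrite old // => pc eb; apply/orP; right; apply/(IH _ wf).
by exists c, p; rewrite mem_cat cn.
Qed.

Definition is_con (h : store) (a : addr) : bool :=
  if lookup h a is Some (NCon _ _) then true else false.

Definition is_con_of (P : pfun) (h : store) (a : addr) : bool :=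
  if lookup h a is Some (NCon Q _) then Q == P else false.

(** The size of the dag rooted at a: only constructor vertices count. *)
Definition vsize (h : store) (a : addr) : nat :=
  count (is_con h) (reach h [:: a]).

(** The vertex a is the root of a dag of (unramified) ground type A. *)
Inductive vtyped (h : store) : addr -> gty -> Prop :=
| V_Unit a :
    lookup h a = Some NUnit -> vtyped h a GUnit
| V_InjL a b A B :
    lookup h a = Some (NInj true b) -> vtyped h b A -> vtyped h a (GSum A B)
| V_InjR a b A B :
    lookup h a = Some (NInj false b) -> vtyped h b B -> vtyped h a (GSum A B)
| V_Pair a b c A B :
    lookup h a = Some (NPair b c) -> vtyped h b A -> vtyped h c B ->
    vtyped h a (GProd A B)
| V_Con a b P :
    lookup h a = Some (NCon P b) -> vtyped h b (gapp P (GMu P)) ->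
    vtyped h a (GMu P).

Definition value (A : gty) (h : store) (a : addr) : Prop :=
  wf_store h /\ vtyped h a A.

Definition node_rel (R : addr -> addr -> Prop) (n n' : node) : Prop :=
  match n, n' with
  | NUnit, NUnit => True
  | NInj j a, NInj j' a' => j = j' /\ R a a'
  | NPair a b, NPair a' b' => R a a' /\ R b b'
  | NCon P a, NCon P' a' => P = P' /\ R a a'
  | _, _ => False
  end.

Definition bisimulation (h h' : store) (R : addr -> addr -> Prop) : Prop :=
  forall a a', R a a' -> exists n n',
    [/\ lookup h a = Some n, lookup h' a' = Some n' & node_rel R n n'].

Definition bisimilar (h : store) (a : addr) (h' : store) (a' : addr) : Prop :=
  exists2 R, bisimulation h h' R & R a a'.

(** k is the least size of a dag bisimilar to the one rooted at a in h. *)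
Definition min_size (h : store) (a : addr) (k : nat) : Prop :=
  (exists h' a',
     [/\ wf_store h', bisimilar h a h' a' & vsize h' a' = k]) /\
  (forall h' a', wf_store h' -> bisimilar h a h' a' -> k <= vsize h' a').

(** * Dynamic-programming semantics *)

Inductive val : Type :=
| Loc of addr
| Clo of seq addr & tm.

Definition alloc (n : node) (h : store) : store := n :: h.

(** Extends h by the numeral of k, whose root is the newest vertex. *)
Fixpoint alloc_numeral (k : nat) (h : store) : store :=
  if k is k'.+1 then
    let h1 := alloc_numeral k' h in
    alloc (NCon natP (size h1)) (alloc (NInj false (size h1).-1) h1)
  else
    alloc (NCon natP (size h).+1) (alloc (NInj true (size h)) (alloc NUnit h)).

Definition memo := addr -> option addr.

(** [pmap M Q h a h' b c]: b represents the image under Q(M) of the Q-structure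
    rooted at a; c counts the nodes of the derivation. *)
Inductive pmap (M : memo) :
    pfun -> store -> addr -> store -> addr -> nat -> Prop :=
| PM_Id h a b :
    M a = Some b -> pmap M PId h a h b 1
| PM_Cst A h a :
    pmap M (PCst A) h a h a 1
| PM_Sum P Q h a j b h1 b1 c :
    lookup h a = Some (NInj j b) ->
    pmap M (if j then P else Q) h b h1 b1 c ->
    pmap M (PSum P Q) h a (alloc (NInj j b1) h1) (size h1) c.+1
| PM_Prod P Q h a b1 b2 h1 d1 c1 h2 d2 c2 :
    lookup h a = Some (NPair b1 b2) ->
    pmap M P h b1 h1 d1 c1 ->
    pmap M Q h1 b2 h2 d2 c2 ->
    pmap M (PProd P Q) h a (alloc (NPair d1 d2) h2) (size h2) (c1 + c2).+1.

(** [eval h r e h' v c]: from the store h and with the variables bound to the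
    vertices r, the term e evaluates to v, leaving the store h', by a derivation
    with c nodes.
    [eval_fold P e0 r vs h M h' M' c] runs the step e0 at the vertices vs in turn
    (bottom-up, so that the memo table M is defined on the predecessors of the
    current vertex) and records each result in the table. *)
Inductive eval : store -> seq addr -> tm -> store -> val -> nat -> Prop :=
| E_Var h r i a :
    onth r i = Some a -> eval h r (Var i) h (Loc a) 1
| E_Lam h r e :
    eval h r (Lam e) h (Clo r e) 1
| E_App h r e1 e2 h1 r' e h2 a h3 v c1 c2 c3 :
    eval h r e1 h1 (Clo r' e) c1 ->
    eval h1 r e2 h2 (Loc a) c2 ->
    eval h2 (a :: r') e h3 v c3 ->
    eval h r (App e1 e2) h3 v (c1 + c2 + c3).+1
| E_Unit h r :
    eval h r Unit (alloc NUnit h) (Loc (size h)) 1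
| E_Pair h r e1 e2 h1 a1 h2 a2 c1 c2 :
    eval h r e1 h1 (Loc a1) c1 ->
    eval h1 r e2 h2 (Loc a2) c2 ->
    eval h r (Pair e1 e2) (alloc (NPair a1 a2) h2) (Loc (size h2)) (c1 + c2).+1
| E_Fst h r e h1 a a1 a2 c :
    eval h r e h1 (Loc a) c -> lookup h1 a = Some (NPair a1 a2) ->
    eval h r (Fst e) h1 (Loc a1) c.+1
| E_Snd h r e h1 a a1 a2 c :
    eval h r e h1 (Loc a) c -> lookup h1 a = Some (NPair a1 a2) ->
    eval h r (Snd e) h1 (Loc a2) c.+1
| E_Inj h r j e h1 a c :
    eval h r e h1 (Loc a) c ->
    eval h r (Inj j e) (alloc (NInj j a) h1) (Loc (size h1)) c.+1
| E_Case h r e e1 e2 h1 a j b h2 v c1 c2 :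
    eval h r e h1 (Loc a) c1 -> lookup h1 a = Some (NInj j b) ->
    eval h1 (b :: r) (if j then e1 else e2) h2 v c2 ->
    eval h r (Case e e1 e2) h2 v (c1 + c2).+1
| E_Con h r m P e h1 a c :
    eval h r e h1 (Loc a) c ->
    eval h r (Con m P e) (alloc (NCon P a) h1) (Loc (size h1)) c.+1
| E_Des h r m P e h1 a b c :
    eval h r e h1 (Loc a) c -> lookup h1 a = Some (NCon P b) ->
    eval h r (Des m P e) h1 (Loc b) c.+1
| E_Fold h r P e0 e1 h1 a h2 M b c1 c2 :
    eval h r e1 h1 (Loc a) c1 ->
    eval_fold P e0 r [seq x <- rev (reach h1 [:: a]) | is_con_of P h1 x]
      h1 (fun _ => None) h2 M c2 ->
    M a = Some b ->
    eval h r (Fold P e0 e1) h2 (Loc b) (c1 + c2).+1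
| E_ToSafe h r e h1 v c :
    eval h r e h1 v c -> eval h r (ToSafe e) h1 v c.+1
| E_ToNorm h r e h1 v c :
    eval h r e h1 v c -> eval h r (ToNorm e) h1 v c.+1
| E_CS h r P e h1 a k c :
    eval h r e h1 (Loc a) c -> min_size h1 a k ->
    eval h r (CS P e) (alloc_numeral k h1)
      (Loc (size (alloc_numeral k h1)).-1) c.+1
with eval_fold : pfun -> tm -> seq addr -> seq addr ->
    store -> memo -> store -> memo -> nat -> Prop :=
| F_Nil P e0 r h M :
    eval_fold P e0 r [::] h M h M 1
| F_Cons P e0 r x vs h M b h1 z c1 h2 w c2 h3 M' c3 :
    lookup h x = Some (NCon P b) ->
    pmap M P h b h1 z c1 ->
    eval h1 (z :: r) e0 h2 (Loc w) c2 ->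
    eval_fold P e0 r vs h2 [eta M with x |-> Some w] h3 M' c3 ->
    eval_fold P e0 r (x :: vs) h M h3 M' (c1 + c2 + c3).+1.

(** The DP-cost of evaluating the closed term f on the value rooted at a in h:
    f is applied to a variable bound to a. *)
Definition DP_cost (f : tm) (h : store) (a : addr) (c : nat) : Prop :=
  exists h' v, eval h [:: a] (App f (Var 0)) h' v c.

(** The evaluation terminates and its cost is bounded. *)
Definition DP_poly_cost (f : tm) (A : gty) : Prop :=
  exists q : {poly nat}, forall h a, value A h a ->
    (exists c, DP_cost f h a c) /\
    (forall c, DP_cost f h a c -> c <= q.[vsize h a]%R).

(* Main.v *)
From Stdlib Require Import Classical.
From mathcomp Require Import all_boot all_algebra zify.
Require Import Defs.

(* Measure a value by the number of constructor vertices reachable from the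
   positions of normal base type in it.  By induction on typing, the cost of a
   term, the number of vertices it allocates, and the measure of its result are
   all bounded by a polynomial in the measure of the environment; safe data
   never contribute.  A fold performs at most one step per constructor vertex
   of its normal argument, and the normal part of the variable bound in the
   step consists of subdags of that argument (the recursive results being
   safe), so every step satisfies the same bound.  A term under toNorm has only
   normal free variables, hence its result can only reach vertices of the normal
   environment and freshly allocated ones, of which there are polynomially many.
   Existence of one evaluation within the bound suffices because evaluation is
   deterministic. *)

Set Implicit Arguments.
Unset Strict Implicit.
Unset Printing Implicit Defensive.


(** * Polynomially bounded functions *)

(** A bound is a plain function that some polynomial dominates, so inequalities between bounds stay
    in natural-number arithmetic. Monotonicity is included because closure under composition relies
    on it. *)
Definition pbounded (p : nat -> nat) : Prop :=
  {homo p : m n / m <= n} /\ exists q : {poly nat}, forall n, p n <= q.[n]%R.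

Lemma pbounded_const k : pbounded (fun=> k).
Proof. by split=> //; exists (k%:P)%R => n; rewrite hornerC. Qed.

Lemma pbounded_id : pbounded id.
Proof. by split=> //; exists 'X%R => n; rewrite hornerX. Qed.

Lemma pbounded_add p1 p2 :
  pbounded p1 -> pbounded p2 -> pbounded (fun n => p1 n + p2 n).
Proof.
move=> [m1 [q1 b1]] [m2 [q2 b2]]; split=> [m n le|].
  by rewrite leq_add ?m1 ?m2.
by exists (q1 + q2)%R => n; rewrite hornerD leq_add.
Qed.

Lemma pbounded_mul p1 p2 :
  pbounded p1 -> pbounded p2 -> pbounded (fun n => p1 n * p2 n).
Proof.
move=> [m1 [q1 b1]] [m2 [q2 b2]]; split=> [m n le|].
  by rewrite leq_mul ?m1 ?m2.
by exists (q1 * q2)%R => n; rewrite hornerM leq_mul.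
Qed.

Lemma pbounded_comp p1 p2 :
  pbounded p1 -> pbounded p2 -> pbounded (fun n => p1 (p2 n)).
Proof.
move=> [m1 [q1 b1]] [m2 [q2 b2]]; split=> [m n le|]; first by rewrite m1 ?m2.
exists (q1 \Po q2)%R => n; rewrite horner_comp.
exact: leq_trans (m1 _ _ (b2 n)) (b1 _).
Qed.

(** * Stores *)

Lemma lookup_lt h a n : lookup h a = Some n -> a < size h.
Proof. by elim: h => //= n' h IH; case: eqP => [-> //|_ /IH/ltnW]. Qed.

Lemma lookup_ex h a : a < size h -> exists n, lookup h a = Some n.
Proof.
elim: h => //= n h IH; rewrite ltnS leq_eqVlt.
by case: eqP => [_ _|_ /=]; [exists n | exact: IH].
Qed.

Lemma lookup_cat g h a : a < size h -> lookup (g ++ h) a = lookup h a.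
Proof.
by move=> lta; elim: g => //= n g IH; rewrite size_cat ltn_eqF // ltn_addl.
Qed.

Lemma lookup_children h a n b :
  wf_store h -> lookup h a = Some n -> b \in children n -> b < a.
Proof. by move=> wf ha hb; apply: (edge_lt wf); rewrite /edge ha. Qed.

Definition ext (h h' : store) : Prop := exists g, h' = g ++ h.

Lemma ext_refl h : ext h h.
Proof. by exists [::]. Qed.

Lemma ext_trans h2 h1 h3 : ext h1 h2 -> ext h2 h3 -> ext h1 h3.
Proof. by move=> [g ->] [g' ->]; exists (g' ++ g); rewrite catA. Qed.

Lemma ext_alloc n h h' : ext h h' -> ext h (alloc n h').
Proof. by move=> [g ->]; exists (n :: g). Qed.

Lemma ext_size h h' : ext h h' -> size h <= size h'.
Proof. by move=> [g ->]; rewrite size_cat leq_addl. Qed.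

Lemma ext_lookup h h' a : ext h h' -> a < size h -> lookup h' a = lookup h a.
Proof. by move=> [g ->]; exact: lookup_cat. Qed.

Lemma ext_lookup_some h h' a n :
  ext h h' -> lookup h a = Some n -> lookup h' a = Some n.
Proof. by move=> he ha; rewrite (ext_lookup he) // (lookup_lt ha). Qed.

Lemma lookup_alloc n h : lookup (alloc n h) (size h) = Some n.
Proof. by rewrite /= eqxx. Qed.

Lemma vtyped_lt h a A : vtyped h a A -> a < size h.
Proof. by case=> *; apply: lookup_lt; eassumption. Qed.

Lemma vtyped_ext h h' a A : ext h h' -> vtyped h a A -> vtyped h' a A.
Proof.
move=> he; elim=> {a A}.
- by move=> a /(ext_lookup_some he); exact: V_Unit.
- by move=> a b A B /(ext_lookup_some he) ha _; exact: V_InjL.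
- by move=> a b A B /(ext_lookup_some he) ha _; exact: V_InjR.
- by move=> a b c A B /(ext_lookup_some he) ha _ hb _; exact: V_Pair ha hb.
- by move=> a b P /(ext_lookup_some he) ha _; exact: V_Con.
Qed.

Lemma vtyped_sum h a A B : vtyped h a (GSum A B) ->
  exists j b, lookup h a = Some (NInj j b) /\ vtyped h b (if j then A else B).
Proof.
by move=> ha; inversion ha; subst; [exists true, b | exists false, b].
Qed.

Lemma vtyped_prod h a A B : vtyped h a (GProd A B) ->
  exists b c, [/\ lookup h a = Some (NPair b c), vtyped h b A & vtyped h c B].
Proof. by move=> ha; inversion ha; subst; exists b, c. Qed.

Lemma vtyped_mu h a P : vtyped h a (GMu P) ->
  exists2 b, lookup h a = Some (NCon P b) & vtyped h b (gapp P (GMu P)).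
Proof. by move=> ha; inversion ha; subst; exists b. Qed.

Lemma vtyped_inj h a j b A B : lookup h a = Some (NInj j b) ->
  vtyped h b (if j then A else B) -> vtyped h a (GSum A B).
Proof. by case: j => ha hb; [exact: V_InjL ha hb | exact: V_InjR ha hb]. Qed.

(** X may contain addresses that h has not allocated yet; only vertices of h impose a condition.
    Confinement depends on this freedom. *)
Definition downclosed (X : addr -> Prop) (h : store) : Prop :=
  forall a n b, lookup h a = Some n -> X a -> b \in children n -> X b.

Lemma downclosed_alloc (X : addr -> Prop) n h :
  downclosed X h -> (forall b, b \in children n -> X b) ->
  downclosed X (alloc n h).
Proof.
by move=> cX cn a n' b /=; case: eqP => [_ [<-] _|_ /cX]; [exact: cn | apply].
Qed.

(** Lets a fold treat every vertex it meets as typed, knowing only the type of the root. *)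
Lemma downclosed_vtyped h : downclosed (fun a => exists A, vtyped h a A) h.
Proof.
move=> a n b ha [A tA]; inversion tA; subst;
  move: ha; rewrite H => -[<-] //=; rewrite !inE;
  move=> /eqP-> || move=> /orP[]/eqP->;
  by eexists; eauto.
Qed.

(** * Reachability *)

Lemma reach_uniq_lt h s :
  uniq (reach h s) /\ forall x, x \in reach h s -> x < size h.
Proof.
elim: h s => //= n h IH s; case: ifP => _; last first.
  by have [u lt] := IH s; split=> // x /lt/ltnW.
have [u lt] := IH (children n ++ s); split=> [|x].
  by rewrite /= u andbT; apply/negP => /lt; rewrite ltnn.
by rewrite inE => /orP[/eqP-> //|/lt/ltnW].
Qed.

Lemma reach_uniq h s : uniq (reach h s).
Proof. by case: (reach_uniq_lt h s). Qed.

Lemma reach_lt h s x : x \in reach h s -> x < size h.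
Proof. by case: (reach_uniq_lt h s) => _; apply. Qed.

Lemma reach_sorted h s : sorted ltn (rev (reach h s)).
Proof.
rewrite rev_sorted; elim: h s => //= n h IH s; case: ifP => // _ /=.
rewrite path_min_sorted ?IH //; apply/allP => x; exact: reach_lt.
Qed.

Lemma reach_nil h : reach h [::] = [::].
Proof. by elim: h. Qed.

(** Reachability arguments below reduce to a choice of X: the typed vertices, the addresses up to a
    given one, or another reachable set. *)
Lemma reach_ind h s (X : addr -> Prop) : downclosed X h ->
  (forall a, a \in s -> X a) -> forall x, x \in reach h s -> X x.
Proof.
elim: h s => //= n h IH s cX sX x.
have cX' : downclosed X h.
  by move=> a n' b ha; apply: cX; rewrite /= ltn_eqF // (lookup_lt ha).
case: ifP => [hs|_]; last exact: IH.
rewrite inE => /orP[/eqP->|]; first exact: sX.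
apply: IH => // a; rewrite mem_cat => /orP[]; last exact: sX.
by apply: (cX (size h)); [rewrite /= eqxx | exact: sX].
Qed.

Lemma reach_downclosed h s : wf_store h -> downclosed (fun x => x \in reach h s) h.
Proof.
move=> wf x n b hx /(reachP _ _ wf)[a [p [as_ lta pa ex]]] bn.
apply/(reachP _ _ wf); exists a, (rcons p b); split=> //.
  by rewrite rcons_path pa -ex /edge hx.
by rewrite last_rcons.
Qed.

Lemma mem_reach h s a : wf_store h -> a < size h -> a \in s -> a \in reach h s.
Proof. by move=> wf lta as_; apply/(reachP _ _ wf); exists a, [::]. Qed.

Lemma reach_sub h s t : wf_store h ->
  (forall a, a \in s -> a \in reach h t) -> {subset reach h s <= reach h t}.
Proof. by move=> wf st; apply: reach_ind st; exact: reach_downclosed. Qed.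

Lemma reach_subset h s t : wf_store h ->
  {subset s <= t} -> {subset reach h s <= reach h t}.
Proof.
move=> wf st x /(reachP _ _ wf)[a [p [/st at_ lta pa ->]]].
by apply/(reachP _ _ wf); exists a, p.
Qed.

Lemma reach_child h a n b : wf_store h ->
  lookup h a = Some n -> b \in children n -> b \in reach h [:: a].
Proof.
move=> wf ha; apply: (reach_downclosed wf ha).
by rewrite mem_reach ?inE ?(lookup_lt ha).
Qed.

Lemma reach_children h a n x : wf_store h -> lookup h a = Some n ->
  x \in reach h [:: a] -> x = a \/ x \in reach h (children n).
Proof.
move=> wf ha; apply: (@reach_ind h [:: a] (fun y => y = a \/ _)) => [|y]; last first.
  by rewrite inE => /eqP; left.
move=> y n' b hy [ey|yr] bn; right; last exact: reach_downclosed hy yr bn.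
move: hy; rewrite ey ha => -[en]; rewrite -en in bn.
apply: mem_reach => //; apply: leq_ltn_trans (lookup_lt ha).
exact: ltnW (lookup_children wf ha bn).
Qed.

Lemma reach_ext h h' s : ext h h' -> (forall a, a \in s -> a < size h) ->
  reach h' s = reach h s.
Proof.
move=> [g ->] lts; elim: g => //= n g IH; case: ifP => // /lts.
by rewrite size_cat ltnNge leq_addl.
Qed.

Lemma is_con_ext h h' a : ext h h' -> a < size h -> is_con h' a = is_con h a.
Proof. by move=> he lta; rewrite /is_con (ext_lookup he lta). Qed.

(** For a single root this is [vsize] by definition. With several roots, a vertex reachable from two
    of them counts once. *)
Definition csize (h : store) (s : seq addr) : nat := count (is_con h) (reach h s).

(** As [reach] has no repetitions, counting reduces to inclusion in a list; later estimates exhibit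
    such a list. *)
Lemma csize_le h s l :
  (forall x, x \in reach h s -> is_con h x -> x \in l) -> csize h s <= size l.
Proof.
move=> sub; rewrite /csize -size_filter; apply: uniq_leq_size.
  by rewrite filter_uniq // reach_uniq.
by move=> x; rewrite mem_filter => /andP[? ?]; exact: sub.
Qed.

Lemma csize_sub h s t :
  (forall x, x \in reach h s -> is_con h x -> x \in reach h t) ->
  csize h s <= csize h t.
Proof.
move=> sub; rewrite [leqRHS]/csize -size_filter.
apply: csize_le => x xs cx; by rewrite mem_filter cx sub.
Qed.

Lemma csize_ext h h' s : ext h h' -> (forall a, a \in s -> a < size h) ->
  csize h' s = csize h s.
Proof.
move=> he lts; rewrite /csize (reach_ext he lts).
by apply: eq_in_count => x /reach_lt; exact: is_con_ext.
Qed.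

Lemma csize_cat h s t : wf_store h -> csize h (s ++ t) <= csize h s + csize h t.
Proof.
move=> wf; rewrite {2 3}/csize -!size_filter -size_cat.
apply: csize_le => x /(reachP _ _ wf)[a [p [+ lta pa ex]]] cx.
move=> as_; rewrite mem_cat !mem_filter cx /=; rewrite mem_cat in as_.
case/orP: as_ => as_; apply/orP; [left | right];
  by apply/(reachP _ _ wf); exists a, p.
Qed.


Scheme eval_mind := Minimality for eval Sort Prop
with eval_fold_mind := Minimality for eval_fold Sort Prop.
Combined Scheme eval_eval_fold_ind from eval_mind, eval_fold_mind.

(** * Determinism *)

Lemma min_size_det h a k1 k2 : min_size h a k1 -> min_size h a k2 -> k1 = k2.
Proof.
move=> [[h1 [a1 [w1 b1 e1]]] min1] [[h2 [a2 [w2 b2 e2]]] min2].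
apply: anti_leq; apply/andP; split; first by rewrite -e2; exact: min1.
by rewrite -e1; exact: min2.
Qed.

(** Identifies one pair of corresponding premises of two derivations. After the substitution the
    next premises start from the same store, so repetition works through the whole rule. *)
Ltac det_step :=
  match goal with
  | H1 : ?x = Some _, H2 : ?x = Some _ |- _ =>
      rewrite H1 in H2; case: H2 => *; subst
  | IH : forall h b c, pmap ?M ?P ?h0 ?a h b c -> _,
    H : pmap ?M ?P ?h0 ?a _ _ _ |- _ =>
      move: (IH _ _ _ H); clear H; case=> *; subst
  | IH : forall h v c, eval ?h0 ?r ?e h v c -> _,
    H : eval ?h0 ?r ?e _ _ _ |- _ =>
      move: (IH _ _ _ H); clear H; case=> *; subst
  | IH : forall h M c, eval_fold ?P ?e0 ?r ?vs ?h0 ?M0 h M c -> _,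
    H : eval_fold ?P ?e0 ?r ?vs ?h0 ?M0 _ _ _ |- _ =>
      move: (IH _ _ _ H); clear H; case=> *; subst
  | H1 : min_size ?h ?a _, H2 : min_size ?h ?a _ |- _ =>
      move: (min_size_det H1 H2); clear H2 => ?; subst
  end.

Lemma pmap_det M P h a h1 b1 c1 h2 b2 c2 :
  pmap M P h a h1 b1 c1 -> pmap M P h a h2 b2 c2 -> (h1, b1, c1) = (h2, b2, c2).
Proof.
move=> ev; elim: ev h2 b2 c2 => {P h a h1 b1 c1} *;
  match goal with
  | H : pmap _ _ _ _ ?h _ _ |- _ = (?h, _, _) => inversion H; subst; clear H
  end;
  by repeat det_step.
Qed.

(** The final tables are equal as functions because both derivations build them by the same
    updates. *)
Lemma eval_eval_fold_det :
  (forall h r e h1 v1 c1, eval h r e h1 v1 c1 ->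
     forall h2 v2 c2, eval h r e h2 v2 c2 -> (h1, v1, c1) = (h2, v2, c2)) /\
  (forall P e0 r vs h M h1 M1 c1, eval_fold P e0 r vs h M h1 M1 c1 ->
     forall h2 M2 c2, eval_fold P e0 r vs h M h2 M2 c2 ->
     (h1, M1, c1) = (h2, M2, c2)).
Proof.
apply: eval_eval_fold_ind => *;
  match goal with
  | H : eval _ _ _ ?h _ _ |- _ = (?h, _, _) => inversion H; subst; clear H
  | H : eval_fold _ _ _ _ _ _ ?h _ _ |- _ = (?h, _, _) =>
      inversion H; subst; clear H
  end;
  by repeat first [det_step | match goal with
    H1 : pmap ?M ?P ?h ?a _ _ _, H2 : pmap ?M ?P ?h ?a _ _ _ |- _ =>
      move: (pmap_det H1 H2); clear H2; case=> *; subst end].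
Qed.

Lemma eval_det h r e h1 v1 c1 h2 v2 c2 :
  eval h r e h1 v1 c1 -> eval h r e h2 v2 c2 -> (h1, v1, c1) = (h2, v2, c2).
Proof. by move=> ev; exact: (eval_eval_fold_det.1 _ _ _ _ _ _ ev). Qed.

(** * Confinement *)

Lemma mem_unbind i s : (i \in unbind s) = (i.+1 \in s).
Proof.
apply/mapP/idP => [[[|j]]|si]; try by rewrite mem_filter //= => js ->.
by exists i.+1; rewrite ?mem_filter.
Qed.

Definition confined (X : addr -> Prop) (r : seq addr) (s : seq nat) : Prop :=
  forall i a, i \in s -> onth r i = Some a -> X a.

Definition confined_val (X : addr -> Prop) (v : val) : Prop :=
  match v with
  | Loc a => X a
  | Clo r e => confined X r (unbind (fv e))
  end.

Lemma confined_cat X r s t :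
  confined X r (s ++ t) -> confined X r s /\ confined X r t.
Proof. by move=> cX; split=> i a hi; apply: cX; rewrite mem_cat hi ?orbT. Qed.

Lemma confined_cons (X : addr -> Prop) a r s :
  X a -> confined X r (unbind s) -> confined X (a :: r) s.
Proof.
by move=> Xa cX [|i] b hi /=; [case=> <- | apply: cX; rewrite mem_unbind].
Qed.

Lemma alloc_numeral_size k h : size (alloc_numeral k h) = size h + 2 * k + 3.
Proof. by elim: k => [|k IH] /=; [lia | rewrite IH; lia]. Qed.

Lemma alloc_numeral_downclosed (X : addr -> Prop) k h : downclosed X h ->
  (forall a, size h <= a -> X a) -> downclosed X (alloc_numeral k h).
Proof.
move=> cX newX; elim: k => [|k IH] /=.
  by repeat apply: downclosed_alloc => //; move=> b; rewrite inE => /eqP->;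
    apply: newX => //=.
by repeat apply: downclosed_alloc => //; move=> b; rewrite inE => /eqP->;
  apply: newX; rewrite alloc_numeral_size; lia.
Qed.

(** A result of [pmap] is an old vertex below a, a memoized result or a fresh vertex, and X contains
    all three kinds. The growth of the store is recorded so that the assumption on fresh addresses
    carries over to the second component of a pair. *)
Lemma pmap_confined M P h a h' b c : pmap M P h a h' b c ->
  size h <= size h' /\
  forall X : addr -> Prop, downclosed X h -> (forall x, size h <= x -> X x) ->
    (forall y w, M y = Some w -> X w) -> X a -> downclosed X h' /\ X b.
Proof.
elim=> {P h a h' b c}.
- by move=> h a b Ma; split=> // X cX _ MX _; split=> //; exact: MX Ma.
- by move=> A h a; split.
- move=> P Q h a j b h1 b1 c ha _ [le IH]; split=> [|X cX nX MX Xa].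
    by rewrite ltnW.
  have Xb : X b by apply: cX ha Xa _; rewrite inE.
  have [cX1 Xb1] := IH X cX nX MX Xb; split; last exact: nX.
  by apply: downclosed_alloc => // y; rewrite inE => /eqP->.
- move=> P Q h a b1 b2 h1 d1 c1 h2 d2 c2 ha _ [le1 IH1] _ [le2 IH2].
  have le12 := leq_trans le1 le2; split=> [|X cX nX MX Xa]; first by rewrite ltnW.
  have Xb1 : X b1 by apply: cX ha Xa _; rewrite inE eqxx.
  have Xb2 : X b2 by apply: cX ha Xa _; rewrite !inE eqxx orbT.
  have [cX1 Xd1] := IH1 X cX nX MX Xb1.
  have [cX2 Xd2] := IH2 X cX1 (fun x lx => nX x (leq_trans le1 lx)) MX Xb2.
  split; last exact: nX.
  by apply: downclosed_alloc => // y; rewrite !inE => /orP[]/eqP->.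
Qed.

(* X contains every address beyond the initial store, so that the same X serves
   for all later stores and only the choice of old vertices matters. *)
Lemma eval_eval_fold_confined :
  (forall h r e h' v c, eval h r e h' v c -> size h <= size h' /\
     forall X : addr -> Prop, downclosed X h -> (forall x, size h <= x -> X x) ->
       confined X r (fv e) -> downclosed X h' /\ confined_val X v) /\
  (forall P e0 r vs h M h' M' c, eval_fold P e0 r vs h M h' M' c ->
     size h <= size h' /\
     forall X : addr -> Prop, downclosed X h -> (forall x, size h <= x -> X x) ->
       confined X r (unbind (fv e0)) -> (forall x, x \in vs -> X x) ->
       (forall y w, M y = Some w -> X w) ->
       downclosed X h' /\ forall y w, M' y = Some w -> X w).
Proof.
(* The assumption on fresh addresses is inherited by later stores. *)
have up (X : addr -> Prop) (h h1 : store) :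
    (forall x, size h <= x -> X x) -> size h <= size h1 ->
    forall x, size h1 <= x -> X x.
  by move=> nX le x lx; apply: nX; exact: leq_trans lx.
apply: eval_eval_fold_ind.
- move=> h r i a ra; split=> // X cX _ eX; split=> //.
  by apply: eX ra; rewrite inE.
- by move=> h r e; split.
- move=> h r e1 e2 h1 r' e h2 a h3 v c1 c2 c3 _ [le1 IH1] _ [le2 IH2] _ [le3 IH3].
  split=> [|X cX nX /confined_cat[eX1 eX2]]; first by lia.
  have [cX1 vX] := IH1 X cX nX eX1.
  have nX1 := up _ _ _ nX le1; have [cX2 Xa] := IH2 X cX1 nX1 eX2.
  by apply: IH3 => //; [exact: up nX1 le2 | exact: confined_cons].
- move=> h r; split=> //= X cX nX _.
  by split; [exact: downclosed_alloc | exact: nX].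
- move=> h r e1 e2 h1 a1 h2 a2 c1 c2 _ [le1 IH1] _ [le2 IH2].
  split=> [|X cX nX /confined_cat[eX1 eX2]]; first by rewrite /=; lia.
  have [cX1 Xa1] := IH1 X cX nX eX1.
  have [cX2 Xa2] := IH2 X cX1 (up _ _ _ nX le1) eX2.
  split; last by apply: nX; lia.
  by apply: downclosed_alloc => // y; rewrite !inE => /orP[]/eqP->.
- move=> h r e h1 a a1 a2 c _ [le IH] ha; split=> // X cX nX eX.
  have [cX1 Xa] := IH X cX nX eX; split=> //.
  by apply: cX1 ha Xa _; rewrite inE eqxx.
- move=> h r e h1 a a1 a2 c _ [le IH] ha; split=> // X cX nX eX.
  have [cX1 Xa] := IH X cX nX eX; split=> //.
  by apply: cX1 ha Xa _; rewrite !inE eqxx orbT.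
- move=> h r j e h1 a c _ [le IH]; split=> [|X cX nX eX]; first by rewrite ltnW.
  have [cX1 Xa] := IH X cX nX eX; split; last exact: nX.
  by apply: downclosed_alloc => // y; rewrite inE => /eqP->.
- move=> h r e e1 e2 h1 a j b h2 v c1 c2 _ [le1 IH1] ha _ [le2 IH2].
  split=> [|X cX nX /confined_cat[eX /confined_cat[eX1 eX2]]]; first by lia.
  have [cX1 Xa] := IH1 X cX nX eX.
  apply: IH2 => //; first exact: up nX le1.
  have Xb : X b by apply: cX1 ha Xa _; rewrite inE.
  by case: (j); exact: confined_cons.
- move=> h r m P e h1 a c _ [le IH]; split=> [|X cX nX eX]; first by rewrite ltnW.
  have [cX1 Xa] := IH X cX nX eX; split; last exact: nX.
  by apply: downclosed_alloc => // y; rewrite inE => /eqP->.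
- move=> h r m P e h1 a b c _ [le IH] ha; split=> // X cX nX eX.
  have [cX1 Xa] := IH X cX nX eX; split=> //.
  by apply: cX1 ha Xa _; rewrite inE eqxx.
- move=> h r P e0 e1 h1 a h2 M b c1 c2 _ [le1 IH1] _ [le2 IH2] Mab.
  split=> [|X cX nX /confined_cat[eX0 eX1]]; first by lia.
  have [cX1 Xa] := IH1 X cX nX eX1.
  (* The fold visits only vertices reachable from a, which lie in X, and it starts with an empty
     table. *)
  have [|//|cX2 MX] := IH2 X cX1 (up _ _ _ nX le1) eX0.
    move=> x; rewrite mem_filter mem_rev => /andP[_]; apply: reach_ind => // y.
    by rewrite inE => /eqP->.
  by split=> //; exact: MX Mab.
- by [].
- by [].
- move=> h r P e h1 a k c _ [le IH] _.
  split=> [|X cX nX eX]; first by rewrite alloc_numeral_size; lia.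
  have [cX1 _] := IH X cX nX eX; split.
    by apply: alloc_numeral_downclosed => //; exact: up nX le.
  by apply: nX; rewrite alloc_numeral_size; lia.
- by [].
- move=> P e0 r x vs h M b h1 z c1 h2 w c2 h3 M' c3 hx /pmap_confined[le1 pX].
  move=> _ [le2 IH1] _ [le3 IH2]; split=> [|X cX nX eX vX MX]; first by lia.
  have Xx : X x by apply: vX; rewrite inE eqxx.
  have Xb : X b by apply: cX hx Xx _; rewrite inE.
  have [cX1 Xz] := pX X cX nX MX Xb.
  have nX1 := up _ _ _ nX le1.
  have [|cX2 Xw] := IH1 X cX1 nX1; first exact: confined_cons.
  apply: IH2 => //; first exact: up nX1 le2.
    by move=> y hy; apply: vX; rewrite inE hy orbT.
  by move=> y w' /=; case: eqP => [_ [<-]|_ /MX].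
Qed.

Lemma eval_confined (X : addr -> Prop) h r e h' v c : eval h r e h' v c ->
  downclosed X h -> (forall x, size h <= x -> X x) -> confined X r (fv e) ->
  downclosed X h' /\ confined_val X v.
Proof. by move=> /(eval_eval_fold_confined.1 _ _ _ _ _ _)[_]; apply. Qed.

(** * Minimal bisimilar dags *)

(** Descent through the attained sizes, starting from that of the value itself; excluded middle
    decides whether a smaller size is attained. *)
Lemma min_size_exists h a : wf_store h -> a < size h ->
  exists2 k, min_size h a k & k <= csize h [:: a].
Proof.
move=> wf lta.
pose S k := exists h' a', [/\ wf_store h', bisimilar h a h' a' & vsize h' a' = k].
(* The dag is bisimilar to itself by the identity on valid addresses, where lookups succeed. *)
have self : S (csize h [:: a]).
  exists h, a; split=> //; exists (fun x y => x = y /\ x < size h) => //.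
  move=> x _ [<- /lookup_ex[n hn]]; exists n, n; split=> //.
  have lt b : b \in children n -> b < size h.
    by move=> /(lookup_children wf hn)/ltn_trans; apply; exact: lookup_lt hn.
  by case: n {hn} lt => //= [j b|b c|P b] lt; rewrite ?lt ?inE ?eqxx ?orbT.
elim/ltn_ind: (csize h [:: a]) self => k IH Sk.
case: (classic (exists2 k', k' < k & S k')) => [[k' lt Sk']|no].
  have [k0 min le] := IH _ lt Sk'; exists k0 => //; exact: leq_trans (ltnW lt).
exists k => //; split=> // h' a' wf' bis; rewrite leqNgt; apply/negP => lt.
by apply: no; exists (vsize h' a') => //; exists h', a'.
Qed.


(** * Erasing and annotating modes *)

Lemma erase_annot m A : erase (annot m A) = A.
Proof. by elim: A => //= A -> B ->. Qed.

Lemma erase_rapp P A : erase (rapp P A) = gapp P (erase A).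
Proof. by elim: P => //= [B|P -> Q ->|P -> Q ->] //; exact: erase_annot. Qed.

Lemma normal_annot A : normal_ty (annot Normal A).
Proof. by elim: A => //= A -> B ->. Qed.

Lemma normal_rapp P A : normal_ty A -> normal_ty (rapp P A).
Proof.
by move=> nA; elim: P => //= [B|P -> Q ->|P -> Q ->] //; exact: normal_annot.
Qed.

(** * Normal parts of values *)

(* The vertices at which the base types of mode Normal of the type A sit in the
   value rooted at a: the only parts of the value the cost may depend on. *)
Fixpoint nroots (h : store) (A : rty) (a : addr) : seq addr :=
  match A with
  | RUnit m | RMu m _ => if m is Normal then [:: a] else [::]
  | RSum B C =>
      if lookup h a is Some (NInj j b) then
        if j then nroots h B b else nroots h C b
      else [::]
  | RProd B C =>
      if lookup h a is Some (NPair b c) then nroots h B b ++ nroots h C c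
      else [::]
  end.

Lemma nroots_annot_safe h A a : nroots h (annot Safe A) a = [::].
Proof.
elim: A a => //= A IHA B IHB a; case: lookup => // -[] //.
  by case.
by move=> b c; rewrite IHA IHB.
Qed.

Lemma nroots_ext h h' A a : ext h h' -> vtyped h a (erase A) ->
  nroots h' A a = nroots h A a.
Proof.
move=> he; elim: A a => //= [A IHA B IHB|A IHA B IHB] a.
  move=> /vtyped_sum[j [b [ha tb]]]; rewrite ha (ext_lookup_some he ha).
  by case: j tb {ha} => tb; [exact: IHA | exact: IHB].
move=> /vtyped_prod[b [c [ha tb tc]]]; rewrite ha (ext_lookup_some he ha).
by rewrite IHA // IHB.
Qed.

Lemma nroots_reach h A a : wf_store h -> vtyped h a (erase A) ->
  {subset nroots h A a <= reach h [:: a]}.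
Proof.
move=> wf; have base a' : a' < size h -> {subset [:: a'] <= reach h [:: a']}.
  by move=> lt x; rewrite inE => /eqP->; rewrite mem_reach ?inE.
elim: A a => [[] a ta x //|[] P a ta x //|A IHA B IHB a|A IHA B IHB a] /=.
- by apply: base; exact: vtyped_lt ta.
- by apply: base; exact: vtyped_lt ta.
- move=> /vtyped_sum[j [b [ha tb]]] x; rewrite ha => hx.
  apply: (reach_sub wf (s := [:: b])) => [y|].
    by rewrite inE => /eqP->; apply: reach_child ha _; rewrite ?inE.
  by case: j tb hx {ha} => tb hx; [exact: IHA | exact: IHB].
move=> /vtyped_prod[b [c [ha tb tc]]] x; rewrite ha mem_cat => /orP[] hx.
  apply: (reach_sub wf (s := [:: b])) => [y|]; last exact: IHA.
  by rewrite inE => /eqP->; apply: reach_child ha _; rewrite ?inE ?eqxx.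
apply: (reach_sub wf (s := [:: c])) => [y|]; last exact: IHB.
by rewrite inE => /eqP->; apply: reach_child ha _; rewrite ?inE ?eqxx ?orbT.
Qed.

Lemma nroots_lt h A a x : wf_store h -> vtyped h a (erase A) ->
  x \in nroots h A a -> x < size h.
Proof. by move=> wf ta /(nroots_reach wf ta)/reach_lt. Qed.

(** At a normal type, the vertices above the normal roots are injections and pairs, which are not
    constructor vertices. *)
Lemma reach_normal h A a x : wf_store h -> normal_ty A -> vtyped h a (erase A) ->
  x \in reach h [:: a] -> is_con h x -> x \in reach h (nroots h A a).
Proof.
move=> wf + + + cx; elim: A a => [[] //|[] //|A IHA B IHB|A IHA B IHB] a /=.
  move=> /andP[nA nB] /vtyped_sum[j [b [ha tb]]] /(reach_children wf ha)[ex|] /=.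
    by move: cx; rewrite ex /is_con ha.
  by rewrite ha; case: j tb {ha} => tb; [exact: IHA | exact: IHB].
move=> /andP[nA nB] /vtyped_prod[b [c [ha tb tc]]].
move=> /(reach_children wf ha)[ex|] /=; first by move: cx; rewrite ex /is_con ha.
rewrite ha => /(reachP _ _ wf)[y [p [+ lty py ex]]].
rewrite !inE => /orP[]/eqP ey; subst y.
  apply: (reach_subset wf (s := nroots h A b)) => [z|].
    by rewrite mem_cat => ->.
  by apply: IHA => //; apply/(reachP _ _ wf); exists b, p; rewrite inE.
apply: (reach_subset wf (s := nroots h B c)) => [z|].
  by rewrite mem_cat orbC => ->.
by apply: IHB => //; apply/(reachP _ _ wf); exists c, p; rewrite inE.
Qed.

Definition nsize (h : store) (A : rty) (a : addr) : nat := csize h (nroots h A a).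

Lemma nsize_ext h h' A a : ext h h' -> wf_store h -> vtyped h a (erase A) ->
  nsize h' A a = nsize h A a.
Proof.
move=> he wf ta; rewrite /nsize (nroots_ext he ta) (csize_ext he) // => x.
exact: nroots_lt.
Qed.

Lemma csize_nil h : csize h [::] = 0.
Proof. by rewrite /csize reach_nil. Qed.

Lemma nsize_annot_safe h A a : nsize h (annot Safe A) a = 0.
Proof. by rewrite /nsize nroots_annot_safe csize_nil. Qed.

Lemma nsize_le h A a : wf_store h -> vtyped h a (erase A) ->
  nsize h A a <= csize h [:: a].
Proof.
move=> wf ta; apply: csize_sub => x hx _; apply: reach_sub hx => //.
exact: nroots_reach.
Qed.

Lemma nsize_normal h A a : wf_store h -> normal_ty A -> vtyped h a (erase A) ->
  csize h [:: a] <= nsize h A a.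
Proof. by move=> wf nA ta; apply: csize_sub => x; exact: reach_normal. Qed.

Lemma csize_child h a n b : wf_store h -> lookup h a = Some n ->
  b \in children n -> csize h [:: b] <= csize h [:: a].
Proof.
move=> wf ha bn; apply: csize_sub => x hx _; apply: reach_sub hx => // y.
by rewrite inE => /eqP->; exact: reach_child ha bn.
Qed.

(** * Environments *)

Fixpoint env (h : store) (G : seq rty) (r : seq addr) : Prop :=
  match G, r with
  | [::], _ => True
  | A :: G', a :: r' => vtyped h a (erase A) /\ env h G' r'
  | _, [::] => False
  end.

Fixpoint eroots (h : store) (G : seq rty) (r : seq addr) : seq addr :=
  match G, r with
  | A :: G', a :: r' => nroots h A a ++ eroots h G' r'
  | _, _ => [::]
  end.

Definition esize (h : store) (G : seq rty) (r : seq addr) : nat :=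
  csize h (eroots h G r).

Lemma env_ext h h' G r : ext h h' -> env h G r -> env h' G r.
Proof.
move=> he; elim: G r => //= A G IH [|a r] //= [ta /IH er]; split=> //.
exact: vtyped_ext ta.
Qed.

Lemma eroots_ext h h' G r : ext h h' -> env h G r -> eroots h' G r = eroots h G r.
Proof.
move=> he; elim: G r => //= A G IH [|a r] //= [ta /IH ->].
by rewrite (nroots_ext he ta).
Qed.

Lemma eroots_lt h G r x :
  wf_store h -> env h G r -> x \in eroots h G r -> x < size h.
Proof.
move=> wf; elim: G r => //= A G IH [|a r] //= [ta er].
by rewrite mem_cat => /orP[/(nroots_lt wf ta)//|/(IH _ er)].
Qed.

Lemma esize_ext h h' G r : ext h h' -> wf_store h -> env h G r ->
  esize h' G r = esize h G r.
Proof.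
move=> he wf er; rewrite /esize (eroots_ext he er) (csize_ext he) // => x.
exact: eroots_lt.
Qed.

Lemma esize_cons h A G a r : wf_store h ->
  esize h (A :: G) (a :: r) <= nsize h A a + esize h G r.
Proof. by move=> wf; exact: csize_cat. Qed.

Lemma env_onth h G r i A : env h G r -> onth G i = Some A ->
  exists a, [/\ onth r i = Some a, vtyped h a (erase A) &
    {subset nroots h A a <= eroots h G r}].
Proof.
elim: G r i => [|B G IH] [|b r] [|i] //= [tb er].
  by case=> <-; exists b; split=> // x; rewrite mem_cat => ->.
move=> /(IH _ _ er)[a [ra ta sub]]; exists a; split=> // x /sub.
by rewrite mem_cat orbC => ->.
Qed.

(** * Allocation *)

Lemma wf_alloc n h : wf_store h -> (forall a, a \in children n -> a < size h) ->
  wf_store (alloc n h).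
Proof. by move=> wf lt /=; rewrite wf andbT; apply/allP. Qed.

Lemma alloc_numeral_ext k h : ext h (alloc_numeral k h).
Proof.
elim: k => [|k IH] /=; last by do 2!apply: ext_alloc.
by do 3!apply: ext_alloc; exact: ext_refl.
Qed.

Lemma alloc_numeral_wf k h : wf_store h -> wf_store (alloc_numeral k h).
Proof.
move=> wf; elim: k => [|k IH] /=; first by rewrite wf /= !ltnSn.
by rewrite IH /= ltnSn andbT alloc_numeral_size; apply/andP; split=> //; lia.
Qed.

Lemma alloc_numeral_vtyped k h :
  vtyped (alloc_numeral k h) (size (alloc_numeral k h)).-1 (GMu natP).
Proof.
elim: k => [|k IH].
  apply: (V_Con (b := (size h).+1)); first by rewrite /= eqxx.
  apply: (V_InjL (b := size h)); first by rewrite /= ltn_eqF // eqxx.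
  by apply: V_Unit; rewrite /= (ltn_eqF (leqnSn _)) (ltn_eqF (leqnn _)) eqxx.
apply: (V_Con (b := size (alloc_numeral k h))); first by rewrite /= eqxx.
apply: (V_InjR (b := (size (alloc_numeral k h)).-1)).
  by rewrite /= ltn_eqF // eqxx.
by apply: vtyped_ext IH => /=; do 2!apply: ext_alloc; exact: ext_refl.
Qed.

(** The numeral shares nothing with h: the addresses from [size h] on are downward closed in the new
    store, and there are [2 * k + 3] of them. *)
Lemma alloc_numeral_csize k h : wf_store h ->
  csize (alloc_numeral k h) [:: (size (alloc_numeral k h)).-1] <= 2 * k + 3.
Proof.
move=> wf; rewrite -[leqRHS](size_iota (size h)); apply: csize_le => x hx _.
rewrite mem_iota addnA -alloc_numeral_size (reach_lt hx) andbT.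
apply: (reach_ind (X := fun a => size h <= a)) hx => [|a].
  by apply: alloc_numeral_downclosed => // a n b /lookup_lt; lia.
by rewrite inE => /eqP->; rewrite alloc_numeral_size; lia.
Qed.

(** * Folds *)

(** Bounds both the derivation and the allocations of [pmap] independently of the data, as [pmap]
    recurses along P and not along the dag. *)
Fixpoint psize (P : pfun) : nat :=
  match P with
  | PId | PCst _ => 1
  | PSum P Q | PProd P Q => (psize P + psize Q).+1
  end.

(** Two stores occur: h0, where the fold starts, holds the argument, while the memoized results live
    in the current store h. *)
Definition is_memo (h0 : store) (s : seq addr) (A : gty) (M : memo) (h : store)
    (P : pfun) : Prop :=
  forall y, y \in s -> is_con_of P h0 y ->
  exists2 w, M y = Some w & vtyped h w A.

(** The normal roots of the image come only from the constants of Q, which are taken over from the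
    argument in h0; the recursive results are safe and contribute none. *)
Lemma pmap_total h0 P A M Q h b :
  wf_store h0 -> ext h0 h -> wf_store h -> vtyped h0 b (gapp Q (GMu P)) ->
  is_memo h0 (reach h0 [:: b]) A M h P ->
  exists h' z c, [/\ pmap M Q h b h' z c, ext h h' /\ wf_store h',
    c <= psize Q, size h' <= size h + psize Q &
    vtyped h' z (gapp Q A) /\
    {subset nroots h' (rapp Q (annot Safe A)) z <= reach h0 [:: b]}].
Proof.
move=> wf0; elim: Q h b => [|B|Q1 IH1 Q2 IH2|Q1 IH1 Q2 IH2] h b he wf /= tb mM.
- have [b' hb _] := vtyped_mu tb.
  have [||w Mb tw] := mM b; first by rewrite mem_reach ?inE ?(lookup_lt hb).
    by rewrite /is_con_of hb.
  exists h, w, 1; split=> //;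
    [exact: PM_Id | by split=> //; exact: ext_refl | by lia |].
  by split=> // x; rewrite nroots_annot_safe.
- exists h, b, 1; split=> //;
    [exact: PM_Cst | by split=> //; exact: ext_refl | by lia |].
  split; first exact: vtyped_ext tb.
  rewrite (nroots_ext he) ?erase_annot //; apply: nroots_reach => //.
  by rewrite erase_annot.
- have [j [b' [hb tb']]] := vtyped_sum tb.
  have sub : {subset reach h0 [:: b'] <= reach h0 [:: b]}.
    apply: reach_sub => // y; rewrite inE => /eqP->.
    by apply: reach_child hb _; rewrite ?inE.
  have mM' : is_memo h0 (reach h0 [:: b']) A M h P by move=> y /sub; exact: mM.
  have [h' [z [c [pm [e' w'] le_c le_h [tz subz]]]]] : exists h' z c,
      [/\ pmap M (if j then Q1 else Q2) h b' h' z c, ext h h' /\ wf_store h',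
        c <= psize (if j then Q1 else Q2),
        size h' <= size h + psize (if j then Q1 else Q2) &
        vtyped h' z (gapp (if j then Q1 else Q2) A) /\
        {subset nroots h' (rapp (if j then Q1 else Q2) (annot Safe A)) z
           <= reach h0 [:: b']}].
    by case: (j) tb' => tb'; [exact: IH1 | exact: IH2].
  have hz := lookup_alloc (NInj j z) h'.
  have ea : ext h' (alloc (NInj j z) h') by apply: ext_alloc; exact: ext_refl.
  exists (alloc (NInj j z) h'), (size h'), c.+1; split.
  + by apply: PM_Sum pm; exact: ext_lookup_some he hb.
  + split; first exact: ext_alloc.
    by apply: wf_alloc => // y; rewrite inE => /eqP->; exact: vtyped_lt tz.
  + by case: (j) le_c; lia.
  + by rewrite /=; case: (j) le_h; lia.
  split; first by apply: (vtyped_inj hz); move: (vtyped_ext ea tz); case: (j).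
  move=> x; rewrite /= eqxx => hx; apply: sub; apply: subz.
  rewrite -(nroots_ext ea); last by rewrite erase_rapp erase_annot.
  by move: hx; case: (j).
have [b1 [b2 [hb tb1 tb2]]] := vtyped_prod tb.
have sub1 : {subset reach h0 [:: b1] <= reach h0 [:: b]}.
  apply: reach_sub => // y; rewrite inE => /eqP->.
  by apply: reach_child hb _; rewrite ?inE ?eqxx.
have sub2 : {subset reach h0 [:: b2] <= reach h0 [:: b]}.
  apply: reach_sub => // y; rewrite inE => /eqP->; apply: reach_child hb _ => //.
  by rewrite !inE eqxx orbT.
have [|h1 [z1 [c1 [pm1 [e1 w1] le_c1 le_h1 [tz1 subz1]]]]] :=
  IH1 h b1 he wf tb1.
  by move=> y /sub1; exact: mM.
have e01 := ext_trans he e1.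
have [|h2 [z2 [c2 [pm2 [e2 w2] le_c2 le_h2 [tz2 subz2]]]]] :=
  IH2 h1 b2 e01 w1 tb2.
  move=> y /sub2 hy cy; have [w Mw tw] := mM y hy cy.
  by exists w => //; exact: vtyped_ext tw.
have hz := lookup_alloc (NPair z1 z2) h2.
have ea : ext h2 (alloc (NPair z1 z2) h2) by apply: ext_alloc; exact: ext_refl.
have ea1 := ext_trans e2 ea.
exists (alloc (NPair z1 z2) h2), (size h2), (c1 + c2).+1; split.
- by apply: PM_Prod pm1 pm2; exact: ext_lookup_some he hb.
- split; first by apply: ext_alloc; exact: ext_trans e2.
  apply: wf_alloc => // y; rewrite !inE => /orP[]/eqP->; last exact: vtyped_lt tz2.
  exact: leq_trans (vtyped_lt tz1) (ext_size e2).
- by lia.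
- by rewrite /=; lia.
split; first exact: V_Pair hz (vtyped_ext ea1 tz1) (vtyped_ext ea tz2).
have er Q : erase (rapp Q (annot Safe A)) = gapp Q A.
  by rewrite erase_rapp erase_annot.
move=> x; rewrite /= eqxx mem_cat => /orP[].
  by rewrite (nroots_ext ea1) ?er // => /subz1; exact: sub1.
by rewrite (nroots_ext ea) ?er // => /subz2; exact: sub2.
Qed.

(** The same b bounds the cost and the number of new vertices, so each term needs only one bounding
    function. *)
Definition runs (R : store -> val -> Prop) (b : nat) (h : store)
    (r : seq addr) (e : tm) : Prop :=
  exists h' v c, [/\ eval h r e h' v c, ext h h' /\ wf_store h', c <= b,
    size h' <= size h + b & R h' v].

(** Generalized to the vertices vs still to be visited, the table being correct on all others. A
    step costs one [F_Cons] node besides [psize P] and B; the final successor is the [F_Nil]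
    node. *)
Lemma fold_total h0 root P A e0 r B :
  wf_store h0 -> vtyped h0 root (GMu P) ->
  (forall h z, ext h0 h -> wf_store h -> vtyped h z (gapp P A) ->
     nsize h (rapp P (annot Safe A)) z <= csize h0 [:: root] ->
     runs (fun h' v => exists2 w, v = Loc w & vtyped h' w A) B h (z :: r) e0) ->
  forall vs h M, ext h0 h -> wf_store h -> sorted ltn vs ->
  {subset vs <= [seq x <- reach h0 [:: root] | is_con_of P h0 x]} ->
  is_memo h0 [seq x <- reach h0 [:: root] | x \notin vs] A M h P ->
  exists h' M' c, [/\ eval_fold P e0 r vs h M h' M' c, ext h h' /\ wf_store h',
    c <= (size vs * (psize P + B).+1).+1,
    size h' <= size h + size vs * (psize P + B) &
    is_memo h0 (reach h0 [:: root]) A M' h' P].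
Proof.
move=> wf0 troot step; elim=> [|x vs IH] h M he wf srt sub mM.
  exists h, M, 1; split=> //;
    [exact: F_Nil | by split=> //; exact: ext_refl | by lia |].
  by move=> y hy; apply: mM; rewrite mem_filter.
have /[!mem_filter]/andP[cx rx] :
    x \in [seq x <- reach h0 [:: root] | is_con_of P h0 x].
  by apply: sub; rewrite inE eqxx.
(* Reachability gives x some type C; the constructor label P of x then determines the type of its
   child. *)
have [C tx] : exists C, vtyped h0 x C.
  apply: (reach_ind (@downclosed_vtyped h0)) rx => y; rewrite inE => /eqP->.
  by exists (GMu P).
have [b hx tb] : exists2 b, lookup h0 x = Some (NCon P b) &
    vtyped h0 b (gapp P (GMu P)).
  move: cx; rewrite /is_con_of; case hx: lookup => [[]|] // => /eqP ep; subst.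
  by inversion tx; subst; move: H; rewrite hx // => -[? ?]; subst; exists b.
have bx : b \in children (NCon P b) by rewrite inE.
have subb : {subset reach h0 [:: b] <= reach h0 [:: root]}.
  by apply: reach_sub => // y; rewrite inE => /eqP->;
    exact: reach_downclosed hx rx bx.
have ltx y : y \in x :: vs -> x <= y.
  move: srt => /= /(order_path_min ltn_trans)/allP all_vs.
  by rewrite inE => /orP[/eqP->|/all_vs/ltnW].
have [|h1 [z [c1 [pm [e1 w1] le_c1 le_h1 [tz subz]]]]] :=
    pmap_total wf0 he wf tb (A := A) (M := M).
  move=> y hy; apply: mM; rewrite mem_filter subb // andbT.
  (* Vertices reachable from the child b are at most b, hence older than x, whereas all of [x :: vs]
     is at least x. So y has been visited already. *)
  have : y < x.
    apply: leq_trans (lookup_children wf0 hx bx).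
    apply: (reach_ind (X := fun u => u <= b)) hy => [u n u' hu leu nu|u].
      exact: leq_trans (ltnW (lookup_children wf0 hu nu)) leu.
    by rewrite inE => /eqP->.
  by rewrite ltnNge; apply: contra; exact: ltx.
have e01 := ext_trans he e1.
have subz0 : {subset nroots h1 (rapp P (annot Safe A)) z <= reach h0 [:: root]}.
  by move=> y /subz/subb.
have [|h2 [v [c2 [ev [e2 w2] le_c2 le_h2 [w vw tw]]]]] := step h1 z e01 w1 tz.
  (* The normal part of z lies inside the argument of the fold, which bounds its measure in every
     step. *)
  rewrite /nsize (csize_ext e01) => [|y /subz0/reach_lt//].
  by apply: csize_sub => y hy _; exact: reach_sub hy.
rewrite vw in ev; have e02 := ext_trans e01 e2.
have [||y|h3 [M' [c3 [fv' [e3 w3] le_c3 le_h3 mM']]]] :=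
    IH h2 [eta M with x |-> Some w] e02 w2.
- exact: path_sorted srt.
- by move=> y hy; apply: sub; rewrite inE hy orbT.
- rewrite mem_filter => /andP[hy ry] cy /=; case: eqP => [_|/eqP nyx].
    by exists w.
  have [|//|w' Mw' tw'] := mM y; first by
    rewrite mem_filter inE negb_or nyx hy ry.
  by exists w' => //; apply: vtyped_ext tw'; exact: ext_trans e2.
exists h3, M', (c1 + c2 + c3).+1; split=> //.
- by apply: F_Cons pm ev fv'; exact: ext_lookup_some he hx.
- by split=> //; apply: ext_trans e3; exact: ext_trans e2.
- by rewrite /= mulSn; lia.
by rewrite /= mulSn; lia.
Qed.


(** * The cost bound *)

Lemma csize_confined h G r e h' a c :
  wf_store h -> ext h h' -> wf_store h' -> env h G r ->
  all (fun i => normal_ty (nth (RUnit Safe) G i)) (fv e) ->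
  eval h r e h' (Loc a) c ->
  csize h' [:: a] <= esize h G r + (size h' - size h).
Proof.
move=> wf he wf' er /allP nfv ev.
(* X consists of the fresh addresses and of the vertices whose reachable constructor vertices all
   lie in the normal part of the environment. *)
pose X b := size h <= b \/
  forall x, x \in reach h [:: b] -> is_con h x -> x \in reach h (eroots h G r).
have [|b ?|i b /nfv|cX Xa] := eval_confined (X := X) ev.
- move=> b n d hb [le|Xb] dn; first by move: le; rewrite leqNgt (lookup_lt hb).
  right=> x hx; apply: Xb; apply: reach_sub hx => // y.
  by rewrite inE => /eqP->; exact: reach_child hb dn.
- by left.
(* The default [RUnit Safe] is not normal, which excludes indices outside G. *)
- rewrite -odflt_onth; case Gi: onth => [A|] //= nA rb.
  have [b' [rb' tb sub]] := env_onth er Gi.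
  right=> x hx cx; move: rb' tb sub; rewrite rb => -[<-] tb sub.
  by apply: (reach_subset wf sub); exact: reach_normal.
(* The covering list: the constructor vertices reachable from the normal roots in h, followed by all
   addresses allocated since. *)
rewrite /esize [csize h _]/csize -size_filter.
rewrite -[X in _ + X](size_iota (size h)) -size_cat.
apply: csize_le => x hx cx; rewrite mem_cat mem_filter mem_iota.
rewrite subnKC ?(ext_size he) // (reach_lt hx) andbT.
have : X x by apply: (reach_ind cX) hx => y; rewrite inE => /eqP->.
case: leqP => [_ _|ltx]; first by rewrite orbT.
case=> [|Xx]; first by rewrite leqNgt ltx.
rewrite (is_con_ext he ltx) in cx.
by rewrite cx Xx // mem_reach ?inE.
Qed.

(* Closures are bounded uniformly in all later stores and arguments; k measures
   the normal part of the argument, m that of the environment. *)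
Fixpoint vgood (p : nat -> nat) (T : ty) (h : store) (m : nat) (v : val) :
    Prop :=
  match T with
  | Ground A =>
      exists a, [/\ v = Loc a, vtyped h a (erase A) & nsize h A a <= p m]
  | Arrow A T' =>
      exists r e, v = Clo r e /\ forall h' a k,
        ext h h' -> wf_store h' -> vtyped h' a (erase A) -> nsize h' A a <= k ->
        runs (fun h'' v' => vgood p T' h'' (m + k) v') (p (m + k)) h' (a :: r) e
  end.

Lemma runs_weaken (R R' : store -> val -> Prop) b b' h r e :
  (forall h' v, R h' v -> R' h' v) -> b <= b' ->
  runs R b h r e -> runs R' b' h r e.
Proof.
move=> RR le [h' [v [c [ev eh lec leh hR]]]]; exists h', v, c; split=> //;
  [exact: leq_trans le | | exact: RR].
by apply: leq_trans leh _; rewrite leq_add2l.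
Qed.

(** The comparison is required for every k because each arrow adds the measure of an argument to
    m. *)
Lemma vgood_weaken p p' T h m m' v : (forall k, p (m + k) <= p' (m' + k)) ->
  vgood p T h m v -> vgood p' T h m' v.
Proof.
elim: T h m m' v => [A|A T IH] h m m' v le /=.
  move=> [a [-> ta lea]]; exists a; split=> //; apply: leq_trans lea _.
  by have := le 0; rewrite !addn0.
move=> [r [e [-> good]]]; exists r, e; split=> // h' a k he wf ta lea.
apply: runs_weaken (good h' a k he wf ta lea) => // h'' v'.
by apply: IH => l; rewrite -!addnA.
Qed.

(** * Bounds for the typing rules *)

(** m is any upper bound of the measure, so estimates of intermediate values can be plugged in
    directly. *)
Definition bounded (p : nat -> nat) (G : seq rty) (e : tm) (T : ty) : Prop :=
  forall h r m, wf_store h -> env h G r -> esize h G r <= m ->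
  runs (fun h' v => vgood p T h' m v) (p m) h r e.

Lemma bounded_var G i A :
  onth G i = Some A -> bounded (fun n => n + 1) G (Var i) (Ground A).
Proof.
move=> Gi h r m wf er lem; have [a [ra ta sub]] := env_onth er Gi.
exists h, (Loc a), 1; split; [exact: E_Var|by split=> //; exact: ext_refl|lia|lia|].
exists a; split=> //; apply: leq_trans (leq_trans lem (leq_addr _ _)).
by apply: csize_sub => x hx _; exact: reach_subset hx.
Qed.

Lemma bounded_lam p G A T e : bounded p (A :: G) e T ->
  bounded (fun n => p n + 1) G (Lam e) (Arrow A T).
Proof.
move=> IH h r m wf er lem; exists h, (Clo r e), 1.
split; [exact: E_Lam|by split=> //; exact: ext_refl|lia|lia|].
exists r, e; split=> // h' a k he wf' ta lea.
apply: (runs_weaken _ _ (IH h' (a :: r) (m + k) wf' _ _)); rewrite ?leq_addr //.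
- by move=> h'' v'; apply: vgood_weaken => l; rewrite leq_addr.
- by split=> //; exact: env_ext er.
apply: leq_trans (esize_cons _ _ _ _ wf') _.
by rewrite addnC leq_add // (esize_ext he).
Qed.

(** The summand [p1 (n + p2 n)] pays for the closure body, which runs with environment measure n and
    an argument of measure at most [p2 n]. *)
Lemma bounded_app p1 p2 G A T e1 e2 : pbounded p1 -> pbounded p2 ->
  bounded p1 G e1 (Arrow A T) -> bounded p2 G e2 (Ground A) ->
  bounded (fun n => p1 n + p2 n + p1 (n + p2 n) + 1) G (App e1 e2) T.
Proof.
move=> [mono1 _] [mono2 _] IH1 IH2 h r m wf er lem.
have [h1 [v1 [c1 [ev1 [he1 wf1] le1 leh1 [r' [e [ev good]]]]]]] :=
  IH1 h r m wf er lem.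
have [|h2 [v2 [c2 [ev2 [he2 wf2] le2 leh2 [a [ea ta lea]]]]]] :=
  IH2 h1 r m wf1 (env_ext he1 er); first by rewrite (esize_ext he1).
have [h3 [v3 [c3 [ev3 [he3 wf3] le3 leh3 good3]]]] :=
  good h2 a (p2 m) he2 wf2 ta lea.
subst v1 v2; exists h3, v3, (c1 + c2 + c3).+1.
split; [exact: E_App ev1 ev2 ev3| | | |].
- by split=> //; apply: ext_trans he3; exact: ext_trans he2.
- by lia.
- by lia.
apply: vgood_weaken good3 => k.
(* When T is an arrow, the result has to stay good after k more units of argument measure. *)
have : p1 (m + p2 m + k) <= p1 (m + k + p2 (m + k)).
  by apply: mono1; have := mono2 m (m + k) (leq_addr _ _); lia.
by lia.
Qed.

Lemma bounded_unit G : bounded (fun=> 1) G Unit (Ground (RUnit Normal)).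
Proof.
move=> h r m wf er lem; exists (alloc NUnit h), (Loc (size h)), 1.
have ha := lookup_alloc NUnit h; have wf' : wf_store (alloc NUnit h) by [].
split; [exact: E_Unit| |lia|rewrite /=; lia|].
  by split=> //; apply: ext_alloc; exact: ext_refl.
exists (size h); split; [by []|exact: V_Unit|].
apply: (csize_le (l := [:: size h])) => x /(reach_children wf' ha)[->|].
  by rewrite inE.
by rewrite reach_nil.
Qed.

Lemma bounded_pair p1 p2 G A B e1 e2 :
  bounded p1 G e1 (Ground A) -> bounded p2 G e2 (Ground B) ->
  bounded (fun n => p1 n + p2 n + 1) G (Pair e1 e2) (Ground (RProd A B)).
Proof.
move=> IH1 IH2 h r m wf er lem.
have [h1 [v1 [c1 [ev1 [he1 wf1] le1 leh1 [a [ea ta lea]]]]]] :=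
  IH1 h r m wf er lem.
have [|h2 [v2 [c2 [ev2 [he2 wf2] le2 leh2 [b [eb tb leb]]]]]] :=
  IH2 h1 r m wf1 (env_ext he1 er); first by rewrite (esize_ext he1).
subst v1 v2; set h3 := alloc (NPair a b) h2.
have he3 : ext h2 h3 by apply: ext_alloc; exact: ext_refl.
have ta2 := vtyped_ext he2 ta.
have wf3 : wf_store h3.
  by apply: wf_alloc => // x; rewrite !inE => /orP[]/eqP->;
    [exact: vtyped_lt ta2 | exact: vtyped_lt tb].
exists h3, (Loc (size h2)), (c1 + c2).+1.
split; [exact: E_Pair ev1 ev2| |lia|rewrite /=; lia|].
  by split=> //; apply: ext_trans he3; exact: ext_trans he2.
exists (size h2); split=> //.
  exact: V_Pair (lookup_alloc _ _) (vtyped_ext he3 ta2) (vtyped_ext he3 tb).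
rewrite /nsize /= eqxx -/h3; apply: leq_trans (csize_cat _ _ wf3) _.
rewrite -/(nsize h3 A a) -/(nsize h3 B b) (nsize_ext he3) // (nsize_ext he3) //.
by rewrite (nsize_ext he2) //; lia.
Qed.

Lemma bounded_fst p G A B e : bounded p G e (Ground (RProd A B)) ->
  bounded (fun n => p n + 1) G (Fst e) (Ground A).
Proof.
move=> IH h r m wf er lem.
have [h1 [v [c [ev [he wf1] le leh [a [ea ta lea]]]]]] := IH h r m wf er lem.
subst v; have [b [d [ha tb td]]] := vtyped_prod ta.
exists h1, (Loc b), c.+1; split; [exact: E_Fst ev ha|by []|lia|lia|].
exists b; split=> //; apply: leq_trans (leq_trans lea (leq_addr _ _)).
apply: csize_sub => x hx _; apply: reach_subset hx => // y hy.
by rewrite /= ha mem_cat hy.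
Qed.

Lemma bounded_snd p G A B e : bounded p G e (Ground (RProd A B)) ->
  bounded (fun n => p n + 1) G (Snd e) (Ground B).
Proof.
move=> IH h r m wf er lem.
have [h1 [v [c [ev [he wf1] le leh [a [ea ta lea]]]]]] := IH h r m wf er lem.
subst v; have [b [d [ha tb td]]] := vtyped_prod ta.
exists h1, (Loc d), c.+1; split; [exact: E_Snd ev ha|by []|lia|lia|].
exists d; split=> //; apply: leq_trans (leq_trans lea (leq_addr _ _)).
apply: csize_sub => x hx _; apply: reach_subset hx => // y hy.
by rewrite /= ha mem_cat hy orbT.
Qed.

Lemma bounded_inj p G A B j e : bounded p G e (Ground (if j then A else B)) ->
  bounded (fun n => p n + 1) G (Inj j e) (Ground (RSum A B)).
Proof.
move=> IH h r m wf er lem.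
have [h1 [v [c [ev [he wf1] le leh [a [ea ta lea]]]]]] := IH h r m wf er lem.
subst v; set h2 := alloc (NInj j a) h1.
have he2 : ext h1 h2 by apply: ext_alloc; exact: ext_refl.
exists h2, (Loc (size h1)), c.+1; split; [exact: E_Inj ev| |lia|rewrite /=; lia|].
  split; first exact: ext_trans he2.
  by apply: wf_alloc => // x; rewrite inE => /eqP->; exact: vtyped_lt ta.
exists (size h1); split=> //.
  apply: (vtyped_inj (lookup_alloc _ _)).
  by move: (vtyped_ext he2 ta); rewrite (fun_if erase).
apply: leq_trans (leq_trans lea (leq_addr _ _)).
rewrite -(nsize_ext he2 wf1 ta) /nsize [nroots _ (RSum _ _) _]/= eqxx -/h2.
by case: (j).
Qed.

(** A branch sees, besides the environment, a component whose normal part is that of the scrutinee,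
    hence the argument [n + p n]. *)
Lemma bounded_case p p1 p2 G A B C e e1 e2 :
  bounded p G e (Ground (RSum A B)) ->
  bounded p1 (A :: G) e1 (Ground C) -> bounded p2 (B :: G) e2 (Ground C) ->
  bounded (fun n => p n + p1 (n + p n) + p2 (n + p n) + 1) G
    (Case e e1 e2) (Ground C).
Proof.
move=> IH IH1 IH2 h r m wf er lem.
have [h1 [v [c [ev [he wf1] le leh [a [ea ta lea]]]]]] := IH h r m wf er lem.
subst v; have [j [b [ha tb]]] := vtyped_sum ta.
have tb' : vtyped h1 b (erase (if j then A else B)) by case: (j) tb.
have leb : nsize h1 (if j then A else B) b <= p m.
  by move: lea; rewrite /nsize /= ha; case: (j).
have er1 := env_ext he er.
have les : esize h1 ((if j then A else B) :: G) (b :: r) <= m + p m.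
  apply: leq_trans (esize_cons _ _ _ _ wf1) _.
  by rewrite addnC leq_add // (esize_ext he).
(* Both branches are weakened to the sum of their bounds, since the data decide which one runs. *)
have {IH1 IH2} : runs
    (fun h' v => vgood (fun n => p1 n + p2 n) (Ground C) h' (m + p m) v)
    (p1 (m + p m) + p2 (m + p m)) h1 (b :: r) (if j then e1 else e2).
  case: (j) tb' les => tb' les.
    apply: (runs_weaken _ _ (IH1 h1 (b :: r) (m + p m) wf1 _ les));
      rewrite ?leq_addr //.
    by move=> h' v; apply: vgood_weaken => k; rewrite leq_addr.
  apply: (runs_weaken _ _ (IH2 h1 (b :: r) (m + p m) wf1 _ les));
    rewrite ?leq_addl //.
  by move=> h' v; apply: vgood_weaken => k; rewrite leq_addl.
move=> [h2 [v [c2 [ev2 [he2 wf2] le2 leh2 [w [ew tw lew]]]]]]; subst v.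
exists h2, (Loc w), (c + c2).+1; split; [exact: E_Case ev ha ev2| |lia|lia|].
  by split=> //; exact: ext_trans he2.
by exists w; split=> //; lia.
Qed.

(** Covers both modes, which differ only in the types A and B and in the reason for the inequality
    on [nsize]. [bounded_des] is organized likewise. *)
Lemma bounded_con p G Q P A B e : erase A = gapp P (GMu P) -> erase B = GMu P ->
  (forall h a, wf_store h -> vtyped h a (GMu P) ->
     forall b, lookup h a = Some (NCon P b) -> nsize h B a <= nsize h A b + 1) ->
  bounded p G e (Ground A) ->
  bounded (fun n => p n + 1) G (Con Q P e) (Ground B).
Proof.
move=> eA eB leAB IH h r m wf er lem.
have [h1 [v [c [ev [he wf1] le leh [a [ea ta lea]]]]]] := IH h r m wf er lem.
subst v; set h2 := alloc (NCon P a) h1.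
have he2 : ext h1 h2 by apply: ext_alloc; exact: ext_refl.
have wf2 : wf_store h2.
  by apply: wf_alloc => // x; rewrite inE => /eqP->; exact: vtyped_lt ta.
have tn : vtyped h2 (size h1) (GMu P).
  by apply: V_Con (lookup_alloc _ _) _; rewrite -eA; exact: vtyped_ext ta.
exists h2, (Loc (size h1)), c.+1; split; [exact: E_Con ev| |lia|rewrite /=; lia|].
  by split=> //; exact: ext_trans he2.
exists (size h1); rewrite eB; split=> //.
apply: leq_trans (leAB _ _ wf2 tn a (lookup_alloc _ _)) _.
by rewrite (nsize_ext he2) // leq_add2r.
Qed.

Lemma bounded_des p G Q P A B e : erase A = GMu P -> erase B = gapp P (GMu P) ->
  (forall h a, wf_store h -> vtyped h a (GMu P) ->
     forall b, lookup h a = Some (NCon P b) -> vtyped h b (gapp P (GMu P)) ->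
     nsize h B b <= nsize h A a) ->
  bounded p G e (Ground A) ->
  bounded (fun n => p n + 1) G (Des Q P e) (Ground B).
Proof.
move=> eA eB leBA IH h r m wf er lem.
have [h1 [v [c [ev [he wf1] le leh [a [ea ta lea]]]]]] := IH h r m wf er lem.
subst v; rewrite eA in ta; have [b ha tb] := vtyped_mu ta.
exists h1, (Loc b), c.+1; split; [exact: E_Des ev ha|by []|lia|lia|].
exists b; rewrite eB; split=> //.
by apply: leq_trans (leBA h1 a wf1 ta b ha tb) _; lia.
Qed.

(** The argument has at most [p1 n] constructor vertices, hence at most that many steps; each runs
    in an environment of measure at most [n + p1 n]. The constant 2 counts the [E_Fold] and [F_Nil]
    nodes. *)
Lemma bounded_fold p0 p1 G P A e0 e1 :
  bounded p0 (rapp P (annot Safe A) :: G) e0 (Ground (annot Safe A)) ->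
  bounded p1 G e1 (Ground (RMu Normal P)) ->
  bounded (fun n => p1 n + p1 n * (psize P + p0 (n + p1 n) + 1) + 2) G
    (Fold P e0 e1) (Ground (annot Safe A)).
Proof.
move=> IH0 IH1 h r m wf er lem.
have [h1 [v [c1 [ev1 [he1 wf1] le1 leh1 [a [ea ta lea]]]]]] :=
  IH1 h r m wf er lem.
subst v; rewrite /nsize /= in lea ta.
set vs := [seq x <- rev (reach h1 [:: a]) | is_con_of P h1 x].
have size_vs : size vs <= p1 m.
  apply: leq_trans lea; rewrite /csize -size_filter; apply: uniq_leq_size.
    by rewrite filter_uniq // rev_uniq reach_uniq.
  move=> x; rewrite !mem_filter mem_rev => /andP[cx ->]; rewrite andbT.
  by move: cx; rewrite /is_con_of /is_con; case: lookup => // -[].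
have [|||| h2 [M [c2 [ev2 [he2 wf2] le2 leh2 mM]]]] :=
    fold_total (e0 := e0) (r := r) (B := p0 (m + p1 m)) (A := A) wf1 ta _
      (vs := vs) (M := fun=> None) (ext_refl h1) wf1.
- move=> h2 z he2 wf2 tz lez.
  apply: (runs_weaken _ _ (IH0 h2 (z :: r) (m + p1 m) wf2 _ _)) => //.
  + by move=> h' v' [w [-> tw _]]; exists w; rewrite // erase_annot in tw.
  + split; first by rewrite erase_rapp erase_annot.
    by apply: env_ext er; exact: ext_trans he2.
  apply: leq_trans (esize_cons _ _ _ _ wf2) _.
  by rewrite (esize_ext (ext_trans he1 he2)) //; lia.
(* [reach] is decreasing, so its reversal visits children before parents. *)
- by apply: sorted_filter; [exact: ltn_trans | exact: reach_sorted].
- by move=> x; rewrite !mem_filter mem_rev.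
(* The empty table is correct because every relevant vertex is still to be visited. *)
- move=> y; rewrite mem_filter => /andP[nv ry] cy; case/negP: nv.
  by rewrite mem_filter cy mem_rev.
have [b ha _] := vtyped_mu ta.
have [||w Mw tw] := mM a.
- by rewrite mem_reach ?inE // (vtyped_lt ta).
- by rewrite /is_con_of ha.
have le_c2 : c2 <= (p1 m * (psize P + p0 (m + p1 m) + 1)).+1.
  by apply: leq_trans le2 _; rewrite ltnS addn1 leq_mul.
have le_h2 : size h2 <= size h1 + p1 m * (psize P + p0 (m + p1 m) + 1).
  by apply: leq_trans leh2 _; rewrite leq_add2l leq_mul // leq_addr.
exists h2, (Loc w), (c1 + c2).+1; split; [exact: E_Fold ev1 ev2 Mw| | | |].
- by split=> //; exact: ext_trans he2.
- by lia.
- by lia.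
by exists w; rewrite erase_annot nsize_annot_safe.
Qed.

Lemma bounded_toSafe p G A e : bounded p G e (Ground A) ->
  bounded (fun n => p n + 1) G (ToSafe e) (Ground (toS A)).
Proof.
move=> IH h r m wf er lem.
have [h1 [v [c [ev [he wf1] le leh [a [ea ta lea]]]]]] := IH h r m wf er lem.
subst v; exists h1, (Loc a), c.+1; split; [exact: E_ToSafe|by []|lia|lia|].
by exists a; rewrite erase_annot nsize_annot_safe.
Qed.

(** A may be safe, in which case its measure says nothing about the size of the result. That size is
    bounded instead by the normal environment plus the at most [p n] allocations. *)
Lemma bounded_toNorm p G A e :
  all (fun i => normal_ty (nth (RUnit Safe) G i)) (fv e) ->
  bounded p G e (Ground A) ->
  bounded (fun n => n + p n + 1) G (ToNorm e) (Ground (toN A)).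
Proof.
move=> nfv IH h r m wf er lem.
have [h1 [v [c [ev [he wf1] le leh [a [ea ta lea]]]]]] := IH h r m wf er lem.
subst v; exists h1, (Loc a), c.+1; split; [exact: E_ToNorm|by []|lia|lia|].
exists a; rewrite erase_annot; split=> //.
apply: leq_trans (nsize_le wf1 _) _; first by rewrite erase_annot.
by have := csize_confined wf he wf1 er nfv ev; lia.
Qed.

(** The minimal size k is at most the size of the value, hence at most [p n]; the numeral then adds
    [2 * k + 3] vertices to the [p n] already allocated. *)
Lemma bounded_cs p G P e : bounded p G e (Ground (RMu Normal P)) ->
  bounded (fun n => 3 * p n + 3) G (CS P e) (Ground (RMu Normal natP)).
Proof.
move=> IH h r m wf er lem.
have [h1 [v [c [ev [he wf1] le leh [a [ea ta lea]]]]]] := IH h r m wf er lem.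
subst v; rewrite /nsize /= in lea.
have [k min lek] := min_size_exists wf1 (vtyped_lt ta).
have lekp : k <= p m by exact: leq_trans lea.
exists (alloc_numeral k h1), (Loc (size (alloc_numeral k h1)).-1), c.+1.
split; [exact: E_CS ev min| |lia|rewrite alloc_numeral_size; lia|].
  split; last exact: alloc_numeral_wf.
  by apply: ext_trans he _; exact: alloc_numeral_ext.
eexists; split; [by []|exact: alloc_numeral_vtyped|].
by apply: leq_trans (alloc_numeral_csize _ wf1) _; lia.
Qed.

Lemma typed_bounded G e T :
  typed G e T -> exists2 p, pbounded p & bounded p G e T.
Proof.
have K k := pbounded_const k; have I := pbounded_id.
have D p1 p2 := @pbounded_add p1 p2; have M p1 p2 := @pbounded_mul p1 p2.
have C p1 p2 := @pbounded_comp p1 p2.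
elim=> {G e T}.
- by move=> G i A Gi; eexists; last exact: bounded_var; exact: D.
- move=> G A T e _ _ [p Pp IH].
  by eexists; last exact: bounded_lam IH; exact: D.
- move=> G A T e1 e2 _ [p1 P1 IH1] _ [p2 P2 IH2].
  eexists; last exact: bounded_app P1 P2 IH1 IH2.
  exact: D (D _ _ (D _ _ P1 P2) (C _ _ P1 (D _ _ I P2))) (K 1).
- by move=> G; eexists; last exact: bounded_unit.
- move=> G A B e1 e2 _ [p1 P1 IH1] _ [p2 P2 IH2].
  eexists; last exact: bounded_pair IH1 IH2.
  exact: D (D _ _ P1 P2) (K 1).
- move=> G A B e _ [p Pp IH].
  by eexists; last exact: bounded_fst IH; exact: D.
- move=> G A B e _ [p Pp IH].
  by eexists; last exact: bounded_snd IH; exact: D.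
- move=> G A B e _ _ [p Pp IH].
  by eexists; last exact: (bounded_inj (j := true) IH); exact: D.
- move=> G A B e _ _ [p Pp IH].
  by eexists; last exact: (bounded_inj (j := false) IH); exact: D.
- move=> G A B R e e1 e2 _ [p Pp IH] _ [p1 P1 IH1] _ [p2 P2 IH2] _.
  eexists; last exact: bounded_case IH IH1 IH2.
  have Pn := D _ _ I Pp.
  exact: D (D _ _ (D _ _ Pp (C _ _ P1 Pn)) (C _ _ P2 Pn)) (K 1).
- move=> G P e _ _ [p Pp IH]; exists (fun n => p n + 1); first exact: D.
  apply: bounded_con IH => //; first exact: erase_rapp.
  move=> h a wf ta b ha; rewrite /nsize /=.
  have tb : vtyped h b (erase (rapp P (RMu Normal P))).
    have [b'] := vtyped_mu ta; rewrite ha erase_rapp => -[->] //.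
  have leb : csize h [:: b] <= nsize h (rapp P (RMu Normal P)) b.
    by apply: nsize_normal => //; exact: normal_rapp.
  apply: leq_trans (leq_add leb (leqnn 1)).
  (* The constructor vertices reachable from a are a itself and those reachable from its child b. *)
  rewrite addnC -[1]/(size [:: a]) [csize _ [:: b]]/csize -size_filter -size_cat.
  apply: csize_le => x /(reach_children wf ha) /= [->|hx] cx; rewrite inE ?eqxx //.
  by rewrite mem_filter cx hx orbT.
- move=> G P e _ _ [p Pp IH]; exists (fun n => p n + 1); first exact: D.
  apply: bounded_con IH => //; first by rewrite erase_annot erase_rapp.
  by move=> h a wf ta b ha; rewrite (nsize_annot_safe h (GMu P)).
- move=> G P e _ [p Pp IH]; exists (fun n => p n + 1); first exact: D.
  apply: bounded_des IH => //; first exact: erase_rapp.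
  move=> h a wf ta b ha tb.
  apply: leq_trans (nsize_le wf _) _; first by rewrite erase_rapp.
  by apply: csize_child ha _; rewrite ?inE.
- move=> G P e _ [p Pp IH]; exists (fun n => p n + 1); first exact: D.
  apply: bounded_des IH => //; first by rewrite erase_annot erase_rapp.
  by move=> h a wf ta b ha tb; rewrite nsize_annot_safe.
- move=> G P A e0 e1 _ _ [p0 P0 IH0] _ [p1 P1 IH1].
  eexists; last exact: bounded_fold IH0 IH1.
  have Pstep : pbounded (fun n => psize P + p0 (n + p1 n) + 1).
    exact: D (D _ _ (K _) (C _ _ P0 (D _ _ I P1))) (K _).
  exact: D (D _ _ P1 (M _ _ P1 Pstep)) (K _).
- move=> G A e _ [p Pp IH].
  by eexists; last exact: bounded_toSafe IH; exact: D.
- move=> G A e _ [p Pp IH] nfv.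
  by eexists; last exact: bounded_toNorm nfv IH; exact: D (D _ _ I Pp) (K 1).
- move=> G P e _ [p Pp IH].
  by eexists; last exact: bounded_cs IH; exact: D (M _ _ (K 3) Pp) (K 3).
Qed.

Theorem theorem22 (f : tm) (g1 g0 : rty)
    (hf : typed [::] f (Arrow g1 (Ground g0))) (hg1 : normal_ty g1) :
  DP_poly_cost f (erase g1).
Proof.
have [p Pp fb] := typed_bounded hf.
(* One p n pays for evaluating f to a closure, the other for the closure body; 2 counts the argument
   variable and the application node. *)
have [_ [q leq_q]] := pbounded_add (pbounded_add Pp Pp) (pbounded_const 2).
exists q => h a [wf ta].
have [c [h' [v ev]] lec] : exists2 c, DP_cost f h a c &
    c <= p (csize h [:: a]) + p (csize h [:: a]) + 2.
  (* Since f is typed in the empty context, its environment has measure 0 although a is bound at run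
     time. *)
  have [|h1 [v1 [c1 [ev1 [he1 wf1] le1 _ [r [e [er good]]]]]]] :=
    fb h [:: a] 0 wf I; first by rewrite /esize csize_nil.
  have ta1 := vtyped_ext he1 ta.
  have les : nsize h1 g1 a <= csize h [:: a].
    by rewrite (nsize_ext he1) // nsize_le.
  have [h2 [v2 [c2 [ev2 _ le2 _ _]]]] := good h1 a _ (ext_refl h1) wf1 ta1 les.
  subst v1; exists (c1 + 1 + c2).+1.
    by exists h2, v2; apply: E_App ev1 _ ev2; exact: E_Var.
  have := Pp.1 0 (csize h [:: a]) (leq0n _); move: le2; rewrite add0n; lia.
split; first by exists c, h', v.
(* Determinism carries the bound from the constructed evaluation to any other. *)
move=> c' [h2 [v2 ev2]]; have [_ _ <-] := eval_det ev ev2.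
exact: leq_trans lec (leq_q _).
Qed.
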